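(* Let $c\in[0,1)$, $b:=\tfrac12-c$, $f_c(x)=\log|\cos\pi(x+c)|$, and $$\alpha(c):=\inf_{\mu\in\mathcal M_T}\int_{\mathbb T} f_c\,d\mu,\qquad m_c^*:=\liminf_{n\to\infty}\frac1n\sum_{k=1}^n\log|\sin\pi(2^kb-b)|.$$ Then: (1) For any $c\in[0,1)$, $\alpha(c)=-\infty$ if and only if $m_c^*=-\infty$. (2) If $\tfrac12-c$ is a periodic point of $T$, then $\alpha(c)=-\infty$. (3) If $\tfrac12-c$ is pre-periodic but not periodic for $T$, then $\alpha(c)>-\infty$. (4) The set of $c\in[0,1)$ such that $\alpha(c)=-\infty$ is a residual set (its complement is of first Baire category). (5) For Lebesgue almost every $c\in[0,1)$, $m_c^*=-\log 2$. (6) $\dim_H\{c\in[0,1):\alpha(c)=-\infty\}=0$.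
   Context: $\mathbb T=\mathbb R/\mathbb Z$ and $T:\mathbb T\to\mathbb T$ is the doubling map $Tx=2x \bmod 1$. $\mathcal M_T$ denotes the set of $T$-invariant Borel probability measures on $\mathbb T$. Note $f_c(x)=\log|\sin\pi(x-b)|$ with $b=\tfrac12-c$, and $f_c(b)=-\infty$; the convention $\log 0=-\infty$ is used. $\dim_H$ is Hausdorff dimension. *)

(* Defs.v *)
From HB Require Import structures.
From mathcomp Require Import all_boot all_order all_algebra.
From mathcomp Require Import all_classical all_reals all_analysis.
Set Implicit Arguments. Unset Strict Implicit. Unset Printing Implicit Defensive.
Import Order.TTheory GRing.Theory Num.Theory.
Import numFieldNormedType.Exports.
Local Open Scope classical_set_scope.
Local Open Scope ring_scope.

Section Defs.
Variable R : realType.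

(* The torus T = R/Z is represented by [0,1) ⊂ R. *)
Definition frac (x : R) : R := x - (Num.floor x)%:~R.

Definition Tdbl (x : R) : R := frac (2 * x).

(* T-invariant Borel probability measures on the torus, seen as Borel
   probability measures on R concentrated on [0,1) *)
Definition invariant_prob (P : probability R R) : Prop :=
  P `[0, 1[%classic = 1%E /\
  forall A : set R, measurable A -> P (Tdbl @^-1` A) = P A.

Definition elog (x : R) : \bar R := if x == 0 then -oo%E else (ln x)%:E.

Definition fc (c x : R) : \bar R := elog `|cos (pi * (x + c))|.

Definition alpha (c : R) : \bar R :=
  ereal_inf [set r | exists P : probability R R,
     invariant_prob P /\ r = (\int[P]_(x in `[0%R, 1%R[) fc c x)%E].

Definition mstar (c : R) : \bar R :=
  let b := 2^-1 - c in
  limn_einf (fun n : nat =>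
    ((n%:R)^-1)%:E * \sum_(1 <= k < n.+1) elog `|sin (pi * (2 ^+ k * b - b))|)%E.

Definition periodic_pt (x : R) : Prop :=
  exists n : nat, (0 < n)%N /\ iter n Tdbl (frac x) = frac x.
Definition preperiodic_pt (x : R) : Prop :=
  exists m : nat, periodic_pt (iter m Tdbl (frac x)).

Definition nowhere_dense (S : set R) : Prop := (closure S)° = set0.
Definition first_category (S : set R) : Prop :=
  exists F : (set R)^nat, (forall n, nowhere_dense (F n)) /\ S `<=` \bigcup_n F n.

Definition diam (U : set R) : \bar R :=
  ereal_sup ([set 0%E] `|` [set (`|x - y|)%:E | x in U & y in U]).

Definition diam_pow (s : R) (U : set R) : R :=
  if U == set0 then 0 else (fine (diam U)) `^ s.

Definition hausdorff_delta (s d : R) (S : set R) : \bar R :=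
  ereal_inf [set r | exists U : (set R)^nat,
    S `<=` \bigcup_i U i /\ (forall i, (diam (U i) <= d%:E)%E) /\
    r = (\sum_(0 <= i <oo) (diam_pow s (U i))%:E)%E].

Definition hausdorff_measure (s : R) (S : set R) : \bar R :=
  ereal_sup [set hausdorff_delta s d S | d in [set d : R | 0 < d]].

Definition hausdorff_dim (S : set R) : \bar R :=
  ereal_inf [set s%:E | s in [set s : R | 0 <= s /\ hausdorff_measure s S = 0%E]].

End Defs.

(* Main.v *)
(* Write b = 1/2 - c, so that f_c(x) = ln |sin pi (x - b)|, and S_n for the sum of
   ln |sin pi (2^k b - b)| over 1 <= k <= n.

   If |sin pi (2^k b - b)| < 2^-(C k) for some k and arbitrarily large C, the
   k-periodic points next to b have very negative integrals. Otherwise the returns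
   of b are at least 2^-(C k) for some C; if then S_n < -M n, a point of period
   (C + 4) n next to b follows b for n steps and has integral below -M / (C + 4)
   up to a constant. Conversely, if S_n >= -A n for all n, an orbit paying for an
   approach to b at scale 2^-m shadows b for a time comparable to m, during which
   it pays at most A per step; so truncations of f_c have Birkhoff sums bounded
   below by -A' n - O(1), uniformly in x, and no ergodic theorem is needed.
   This gives (1)-(3), and (4) because { b : returns >= 2^-(C k) } is nowhere dense.

   For (5), g(x) = ln |2 sin pi x| satisfies sum_(j < q) g(y + p j / q) =
   (q / m) g(m y), where m >= q / p is the order of e^(2 i pi p / q). Averaging
   over translations by j / q bounds the correlation of g(p x) and g(q x) by
   O(p / q); with the frequencies 2^k - 1 the sum of g((2^k - 1) x) over k <= n has
   second moment O(n), hence is o(n) almost everywhere along squares, and along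
   all n by monotonicity of S_n.

   For (6), let n be the first time with S_n <= -M n. Reading the digits of b from
   left to right, a close return at time k is a copy of a prefix of b, and it costs
   at most M + O(1) per digit by minimality of n, whereas a digit outside of the
   long copies has bounded cost. Hence all but O(n / M) of the digits are copied,
   there are at most 2^(eps n) such words, and the set has dimension 0. *)
Require Import Defs.
From HB Require Import structures.
From mathcomp Require Import all_boot all_order all_algebra.
From mathcomp Require Import all_classical all_reals all_analysis.
From mathcomp Require Import measurable_realfun.
From mathcomp Require Import zify ring lra.
From mathcomp.real_closed Require complex.
Import Order.TTheory GRing.Theory Num.Theory.
Import numFieldNormedType.Exports.
Set Implicit Arguments. Unset Strict Implicit. Unset Printing Implicit Defensive.
Local Open Scope classical_set_scope.
Local Open Scope ring_scope.
Local Notation frac := (@Defs.frac _).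

(** * The torus norm |sin pi x| *)

Section SineNorm.
Variable R : realType.
Implicit Types x y b c : R.

(** An even, 1-periodic, subadditive substitute for the distance to the nearest integer, to which it
    is comparable with constants 1 and 4; it works on real lifts, without reduction modulo 1. *)
Definition snorm x : R := `|sin (pi * x)|.

Lemma snorm_ge0 x : 0 <= snorm x.
Proof. exact: normr_ge0. Qed.

Lemma snorm_le1 x : snorm x <= 1.
Proof. exact: sin_max. Qed.

Lemma snorm0 : snorm 0 = 0.
Proof. by rewrite /snorm mulr0 sin0 normr0. Qed.

Lemma snormN x : snorm (- x) = snorm x.
Proof. by rewrite /snorm mulrN sinN normrN. Qed.

Lemma snormD1 x : snorm (x + 1) = snorm x.
Proof. by rewrite /snorm mulrDr mulr1 sinDpi normrN. Qed.

Lemma snormDn x n : snorm (x + n%:R) = snorm x.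
Proof.
elim: n => [|n IH]; first by rewrite addr0.
by rewrite -natr1 addrA snormD1.
Qed.

Lemma snormDz x (z : int) : snorm (x + z%:~R) = snorm x.
Proof.
case: z => n; first by rewrite -pmulrn snormDn.
by rewrite NegzE mulrNz -[RHS](snormDn _ n.+1) -[in RHS](subrK n.+1%:R x) snormDn snormDn.
Qed.

Lemma snormBz x (z : int) : snorm (x - z%:~R) = snorm x.
Proof. by rewrite -mulrNz snormDz. Qed.

Lemma ler_snormD x y : snorm (x + y) <= snorm x + snorm y.
Proof.
rewrite /snorm mulrDr sinD (le_trans (ler_normD _ _))// !normrM.
by apply: lerD; [rewrite ler_piMr// cos_max|rewrite ler_piMl// cos_max].
Qed.

Lemma ler_snormB x y : snorm x - snorm y <= snorm (x - y).
Proof. by rewrite lerBlDr -{1}(subrK y x) ler_snormD. Qed.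

Lemma ler_snormMn n x : snorm (n%:R * x) <= n%:R * snorm x.
Proof.
elim: n => [|n IH]; first by rewrite !mul0r snorm0.
by rewrite -natr1 !mulrDl !mul1r (le_trans (ler_snormD _ _))// lerD2r.
Qed.

Lemma sin_le_id x : 0 <= x -> sin x <= x.
Proof.
move=> x0.
have : forall a b : R, 0 <= a <= b -> a - sin a <= b - sin b.
  move=> a b /andP[a0 ab].
  apply: (@ger0_derive1_le_cc R (fun t => t - sin t) a b) => //.
  - move=> t _; rewrite derive1E deriveB// derive_id derive_val subr_ge0.
    exact: cos_le1.
  - by apply: continuous_subspaceT => t; apply: cvgB; [exact: cvg_id|exact: continuous_sin].
  - by rewrite in_itv/= lexx.
  - by rewrite in_itv/= lexx ab.
move/(_ 0 x); rewrite lexx x0 => /(_ isT).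
by rewrite sin0 subr0 subr_ge0.
Qed.

Lemma snorm_le x : snorm x <= 4 * `|x|.
Proof.
suff H y : 0 <= y -> `|sin y| <= y.
  have pix : `|pi * x| = pi * `|x| by rewrite normrM gtr0_norm// pi_gt0.
  have : snorm x <= pi * `|x|.
    rewrite -pix /snorm; have [h|h] := leP 0 (pi * x).
      by rewrite (ger0_norm h) H.
    by rewrite (ltr0_norm h) -normrN -sinN H// oppr_ge0 ltW.
  move=> /le_trans; apply; rewrite ler_wpM2r//.
  by have := @pihalf_lt2 R; lra.
move=> y0; have [y1|y1] := leP y 1.
  rewrite ger0_norm ?sin_le_id// sin_ge0_pi// y0 (le_trans y1)//.
  by have := @pi_ge2 R; lra.
by rewrite (le_trans (sin_max y))// ltW.
Qed.

End SineNorm.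

Section SineNormLower.
Variable R : realType.
Implicit Types x y b c : R.

(** As pi >= 2, it suffices that y / 2 <= sin y on [0, pi / 2]. For y = 2 z, duplication and the
    mean value theorem give sin y = 2 z cos t cos z with t <= z <= pi / 4, and both cosines have
    square at least 1 / 2. *)
Lemma snorm_ge x : `|x| <= 2^-1 -> `|x| <= snorm x.
Proof.
have pi2 := @pi_ge2 R; have pi4 := @pihalf_lt2 R.
have cosq (z : R) : 0 <= z <= pi / 4 -> 0 <= cos z /\ 2^-1 <= cos z ^+ 2.
  move=> /andP[z0 z1]; split; first by apply: cos_ge0_pihalf; lra.
  have : 0 <= cos (z *+ 2).
    by apply: cos_ge0_pihalf; rewrite (mulr2n z); lra.
  by rewrite cos_mulr2n (mulr2n (_ ^+ _)); lra.
have H (z : R) : 0 <= z <= pi / 4 -> z <= sin (z *+ 2).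
  move=> /[dup] zz /andP[z0 z1]; have [c0 c1] := cosq _ zz.
  have := @MVT_segment R (@sin R) (@cos R) 0 z z0.
  case=> [|t].
  - by apply: continuous_subspaceT => t; exact: continuous_sin.
  rewrite in_itv/= sin0 !subr0 => /andP[t0 t1] sE.
  have [d0 d1] : 0 <= cos t /\ 2^-1 <= cos t ^+ 2 by apply: cosq; lra.
  have cc : 2^-1 <= cos z * cos t.
    rewrite -(@ler_pXn2r _ 2) ?nnegrE ?mulr_ge0 ?invr_ge0 ?ler0n//.
    by rewrite exprMn (@le_trans _ _ (2^-1 * 2^-1)) ?ler_pM ?invr_ge0 ?ler0n//; lra.
  by rewrite sin_mulr2n sE (mulr2n (_ * _)); nra.
have K y : 0 <= y <= pi / 2 -> y / 2 <= sin y.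
  by move=> yy; have /= := H (y / 2); rewrite -[y / 2 *+ 2]mulr_natr divfK//; apply; lra.
move=> x2; have [x0|x0] := leP 0 x.
  rewrite /snorm; move: x2; rewrite (ger0_norm x0) => x2.
  have /K : 0 <= pi * x <= pi / 2 by apply/andP; split; nra.
  by move=> h; rewrite (le_trans _ (ler_norm _))// (le_trans _ h)//; nra.
rewrite -[snorm x]snormN /snorm; move: x2; rewrite (ltr0_norm x0) => x2.
have /K : 0 <= pi * - x <= pi / 2 by apply/andP; split; nra.
by move=> h; rewrite (le_trans _ (ler_norm _))// (le_trans _ h)//; nra.
Qed.

Lemma snorm_near x : exists z : int, `|x - z%:~R| <= snorm x.
Proof.
exists (Num.floor (x + 2^-1)); rewrite -(snormBz _ (Num.floor (x + 2^-1))).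
apply: snorm_ge; rewrite ler_norml.
have := floor_le (x + 2^-1); have := floorD1_gt (x + 2^-1).
by rewrite intrD; lra.
Qed.

Lemma snorm_eq0 x : snorm x = 0 -> exists z : int, x = z%:~R.
Proof.
move=> x0; have [z] := snorm_near x; rewrite x0 normr_le0 subr_eq0 => /eqP.
by exists z.
Qed.

Lemma ler_snormM2 k x : snorm (2 ^+ k * x) <= 2 ^+ k * snorm x.
Proof. by have := ler_snormMn (2 ^ k) x; rewrite natrX. Qed.

Lemma frac_itv x : 0 <= frac x < 1.
Proof.
have := floor_le x; have := floorD1_gt x; rewrite /frac intrD; lra.
Qed.

Lemma fracDz x (z : int) : frac (x + z%:~R) = frac x.
Proof. by rewrite /frac floorDrz ?intr_int// intrKfloor intrD; ring. Qed.

Lemma frac_id x : 0 <= x < 1 -> frac x = x.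
Proof.
by move=> xx; rewrite /frac (floor_def (m := 0)) ?subr0//; rewrite add0r.
Qed.

(** The successor matters: the zeroth iterate is x itself, which need not lie in [0, 1). *)
Lemma iter_TdblS k x : iter k.+1 (@Tdbl R) x = frac (2 ^+ k.+1 * x).
Proof.
elim: k => [|k IH]; first by rewrite expr1.
rewrite iterS IH /Tdbl {2}/frac; set z := Num.floor _.
by rewrite mulrBr -(intrM _ 2) -mulrNz fracDz [in RHS]exprS mulrA.
Qed.

Lemma iter_Tdbl k x : 0 <= x < 1 -> iter k (@Tdbl R) x = frac (2 ^+ k * x).
Proof.
by case: k => [|k] xx; [rewrite /= expr0 mul1r frac_id|rewrite iter_TdblS].
Qed.

Lemma snorm_frac x y : snorm (frac x - y) = snorm (x - y).
Proof. by rewrite /frac addrAC snormBz. Qed.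

Lemma snorm_iter_Tdbl k x b : snorm (iter k (@Tdbl R) x - b) = snorm (2 ^+ k * x - b).
Proof.
by case: k => [|k]; [rewrite /= expr0 mul1r|rewrite iter_TdblS snorm_frac].
Qed.

Lemma fcE c x : fc c x = elog (snorm (x - (2^-1 - c))).
Proof.
rewrite /fc /snorm; congr elog.
rewrite (_ : pi * (x - (2^-1 - c)) = pi * (x + c) - pi / 2); last by lra.
by rewrite sinBpihalf normrN.
Qed.

End SineNormLower.

(** * Close returns of b *)

Lemma eqNy_ltP (R : realType) (x : \bar R) : x = -oo%E <-> forall M : R, (x < M%:E)%E.
Proof.
split=> [->|] M; first exact: ltNyr.
by case: x M => [r /(_ r)|/(_ 0)|]//; rewrite ltxx.
Qed.

Lemma limn_einf_eqNy (R : realType) (u : (\bar R)^nat) :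
  limn_einf u = -oo%E <->
  forall (N : nat) (M : R), exists n, (N <= n)%N /\ (u n < M%:E)%E.
Proof.
rewrite limn_einf_lim (cvg_lim _ (@cvg_einfs_sup _ u))//; split => [H N M|H].
  have : (ereal_inf (sdrop u N) < M%:E)%E.
    rewrite (@le_lt_trans _ _ -oo%E) ?ltNyr// -H.
    by apply: ereal_sup_ubound; exists N.
  by case/ereal_inf_lt => _ [n /= Nn <-] h; exists n.
apply/ereal_sup_ninfty => _ [N _ <-] /=; apply/eqNy_ltP => M.
have [n [Nn un]] := H N M.
by apply: le_lt_trans un; apply: ereal_inf_lbound; exists n.
Qed.

Lemma ln2_ge (R : realType) : 2^-1 <= ln (2 : R).
Proof.
have := @le_ln1Dx R (- 2^-1).
rewrite (_ : 1 + - 2^-1 = 2^-1); last lra.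
by rewrite lnV ?posrE//; lra.
Qed.

Lemma ln2_le1 (R : realType) : ln (2 : R) <= 1.
Proof. by have := @le_ln1Dx R 1; apply; lra. Qed.

Section CloseReturns.
Variable R : realType.
Implicit Types b c : R.

Definition ret b (k : nat) : R := snorm (2 ^+ k * b - b).

Definition retsum b (n : nat) : \bar R := (\sum_(1 <= k < n.+1) elog (ret b k))%E.

(** The real-valued counterpart of [retsum]. They agree only when no return vanishes, because the
    real [ln] is 0 at 0. *)
Definition logsum b (n : nat) : R := \sum_(1 <= k < n.+1) ln (ret b k).

Lemma ret_ge0 b k : 0 <= ret b k. Proof. exact: snorm_ge0. Qed.
Lemma ret_le1 b k : ret b k <= 1. Proof. exact: snorm_le1. Qed.

Lemma elog_le0 (x : R) : x <= 1 -> (elog x <= 0)%E.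
Proof. by move=> x1; rewrite /elog; case: ifP => // _; rewrite lee_fin ln_le0. Qed.

Lemma retsumS b n : retsum b n.+1 = (retsum b n + elog (ret b n.+1))%E.
Proof. by rewrite /retsum big_nat_recr. Qed.

Lemma logsumS b n : logsum b n.+1 = logsum b n + ln (ret b n.+1).
Proof. by rewrite /logsum big_nat_recr. Qed.

Lemma logsum0 b : logsum b 0 = 0.
Proof. by rewrite /logsum big_geq. Qed.

Lemma retsum_le m n b : (m <= n)%N -> (retsum b n <= retsum b m)%E.
Proof.
move/subnK => <-; elim: (n - m)%N => [//|j IH].
rewrite addSn retsumS; apply: le_trans IH.
by rewrite -[leRHS]adde0 leeD2l// elog_le0// ret_le1.
Qed.

Lemma retsumE b n : (forall k, (0 < k <= n)%N -> ret b k != 0) ->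
  retsum b n = (logsum b n)%:E.
Proof.
elim: n => [|n IH] H; first by rewrite logsum0 /retsum big_geq.
rewrite retsumS logsumS IH ?EFinD; last first.
  by move=> k /andP[k0 kn]; apply: H; rewrite k0 (leq_trans kn).
by rewrite /elog (negbTE (H n.+1 _))// leqnn.
Qed.

Lemma retsum_Ny b k n : (0 < k <= n)%N -> ret b k = 0 -> retsum b n = -oo%E.
Proof.
case: k => // k kn r0; apply/eqP; rewrite -leeNy_eq.
apply: le_trans (retsum_le b kn) _; rewrite retsumS r0 /elog eqxx.
by rewrite addeNy.
Qed.

(** One index suffices for each M because the sums are nonincreasing: a bound at n with slope |M| (N
    + 1) carries over to the index (N + 1) n >= N, where the average is then below M. *)
Lemma mstar_eqNy c : mstar c = -oo%E <->
  forall M : R, exists n, (0 < n)%N /\ (retsum (2^-1 - c) n < (- (M * n%:R))%:E)%E.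
Proof.
rewrite /mstar; set b := 2^-1 - c.
rewrite limn_einf_eqNy; split=> [H M|H N M].
  have [n [n0]] := H 1%N (- M); rewrite -[X in (_ * X)%E]/(retsum b n) => h.
  exists n; split => //.
  by rewrite muleC lte_pdivrMr ?ltr0n// in h; rewrite -mulNr.
have [n [n0 h]] := H (`|M| * N.+1%:R).
exists (N.+1 * n)%N; split; first by rewrite (leq_trans (leqnSn N))// leq_pmulr.
rewrite -[X in (_ * X)%E]/(retsum b _).
rewrite muleC lte_pdivrMr ?ltr0n ?muln_gt0//.
apply: (le_lt_trans (retsum_le b (leq_pmull n (ltn0Sn N)))).
apply: (lt_le_trans h); rewrite lee_fin natrM mulrA -mulNr.
by rewrite !ler_wpM2r// -mulNr ler_wpM2r// lerNl -normrN ler_norm.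
Qed.

Lemma mstar_neqNy c : mstar c != -oo%E -> let b := 2^-1 - c in
  exists A : nat, (forall k, (0 < k)%N -> 0 < ret b k) /\
    (forall n, - logsum b n <= A%:R * n%:R).
Proof.
move=> /eqP/mstar_eqNy/existsNP[M] HM b.
have {}HM n : (0 < n)%N -> ((- (M * n%:R))%:E <= retsum b n)%E.
  move=> n0; rewrite leNgt; apply/negP => h; apply: HM.
  by exists n.
have pos k : (0 < k)%N -> 0 < ret b k.
  move=> k0; rewrite lt_neqAle ret_ge0 andbT eq_sym; apply/eqP => r0.
  by have := HM k k0; rewrite (@retsum_Ny _ k) ?k0 ?leqnn// leeNy_eq.
exists (Num.trunc `|M|).+1; split=> // -[|n].
  by rewrite logsum0 oppr0 mulr0.
have := HM n.+1 isT; rewrite retsumE ?lee_fin; last first.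
  by move=> k /andP[k0 _]; rewrite gt_eqF// pos.
rewrite lerNl => /le_trans; apply; rewrite ler_wpM2r//.
by rewrite (le_trans (ler_norm M))// ltW// truncnS_gt.
Qed.

(** The arguments below split according to whether some C satisfies this or none does. *)
Definition slow_returns b (C : nat) :=
  forall k, (0 < k)%N -> 2 ^- (C * k) <= ret b k.

Lemma ln_ret_le0 b k : ln (ret b k) <= 0.
Proof. by rewrite ln_le0// ret_le1. Qed.

Lemma logsum_le m n b : (m <= n)%N -> logsum b n <= logsum b m.
Proof.
move/subnK => <-; elim: (n - m)%N => [//|j IH].
by rewrite addSn logsumS (le_trans _ IH)// gerDl ln_ret_le0.
Qed.

(** All terms are nonpositive, so the k-th one is at least the whole sum, hence at least -A k. The
    rate 2 A converts to base 2, since ln 2 >= 1 / 2. *)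
Lemma logsum_slow b (A : nat) :
  (forall k, (0 < k)%N -> 0 < ret b k) ->
  (forall n, - logsum b n <= A%:R * n%:R) -> exists C, slow_returns b C.
Proof.
move=> pos HA; exists (2 * A)%N => -[//|k] k0.
rewrite -ler_ln ?posrE ?pos ?invr_gt0 ?exprn_gt0// lnV ?posrE ?exprn_gt0//.
rewrite lnXn// lerNl -(mulr_natl (ln 2)).
have := HA k.+1; have : ln (ret b k.+1) >= logsum b k.+1.
  by rewrite logsumS gerDr (le_trans (logsum_le b (leq0n k)))// logsum0.
have := ler_wpM2l (ler0n R (2 * A * k.+1)) (@ln2_ge R).
by rewrite !natrM; nra.
Qed.

End CloseReturns.

(** * Orbit measures and the upper bound on alpha *)

Section OrbitMeasure.
Variable R : realType.
Implicit Types b c p : R.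

Lemma measurable_elog : measurable_fun [set: R] (@elog R).
Proof.
apply: measurable_fun_ifT => //.
- exact: measurable_fun_eqr.
- apply/measurable_EFinP; exact: measurable_ln.
Qed.

Lemma continuous_snorm : continuous (@snorm R).
Proof.
move=> x; apply: (@continuous_comp _ _ _ (fun x => sin (pi * x)) (fun y => `|y|)).
  apply: (@continuous_comp _ _ _ (fun x => pi * x) sin).
    exact: mulrl_continuous.
  exact: continuous_sin.
exact: norm_continuous.
Qed.

Lemma measurable_snorm : measurable_fun [set: R] (@snorm R).
Proof. by apply: continuous_measurable_fun; exact: continuous_snorm. Qed.

Lemma measurable_fc c : measurable_fun [set: R] (fc c).
Proof.
rewrite (_ : fc c = @elog R \o (@snorm R \o (fun x => x - (2^-1 - c)))).
  apply: measurableT_comp; first exact: measurable_elog.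
  apply: measurableT_comp; first exact: measurable_snorm.
  exact: measurable_funB.
by apply/funext => x; rewrite /= fcE.
Qed.

Lemma fc_le0 c x : (fc c x <= 0)%E.
Proof. by rewrite fcE elog_le0// snorm_le1. Qed.

(** The measure is the mean of the n Dirac masses along the orbit, with repetitions if n is not the
    minimal period. *)
Lemma orbit_measure p n : (0 < n)%N -> 0 <= p < 1 -> iter n (@Tdbl R) p = p ->
  exists P : probability R R, invariant_prob P /\
   forall h : R -> \bar R, measurable_fun setT h -> (forall x, (0 <= h x)%E) ->
     (\int[P]_(x in `[0%R, 1%R[) h x =
      (n%:R^-1)%:E * \sum_(k < n) h (iter k (@Tdbl R) p))%E.
Proof.
move=> n0 p01 Tnp.
pose orb := fun k : nat => (\d_(iter k (@Tdbl R) p) : {measure set R -> \bar R}).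
pose mu : {measure set R -> \bar R} := msum orb n.
have orb01 k : 0 <= iter k (@Tdbl R) p < 1.
  by case: k => [//|k]; rewrite iterS frac_itv.
have muT : mu setT = n%:R%:E.
  transitivity (\sum_(k < n) (1%:E : \bar R))%E.
    by apply: eq_bigr => k _; exact: diracT.
  by rewrite sumEFin sumr_const card_ord.
have nN0 : n%:R != 0 :> R by rewrite pnatr_eq0 -lt0n.
(* The second argument of [mnormalize] is a default for total mass 0 or infinity; here the mass is
   n. *)
pose P : probability R R := mnormalize mu (\d_(0 : R) : probability R R).
have PE A : P A = (mu A * (n%:R^-1)%:E)%E.
  rewrite /P/= /mnormalize; lazy zeta; rewrite muT.
  by rewrite eqe (negbTE nN0).
exists P; split; last first.
  move=> h mh h0.
  pose c := NngNum (ltac:(by rewrite invr_ge0 ler0n) : 0 <= n%:R^-1 :> R).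
  rewrite (eq_measure_integral (mscale c mu)); last first.
    by move=> A mA _; exact: (etrans (PE A) (muleC _ _)).
  rewrite ge0_integral_mscale//; last exact: measurable_funTS.
  rewrite ge0_integral_measure_sum//; last exact: measurable_funTS.
  congr (_ * _)%E; apply: eq_bigr => k _.
  rewrite integral_dirac//; last exact: measurable_funTS.
  by rewrite diracE mem_set ?mul1e//= in_itv/= orb01.
split=> [|A mA].
  rewrite PE.
  have -> : mu `[0%R, 1%R[%classic = mu setT.
    apply: eq_bigr => k _.
    rewrite [RHS](_ : _ = 1%E); last exact: diracT.
    by rewrite /orb/= diracE mem_set//= in_itv/= orb01.
  by rewrite muT -EFinM divff.
rewrite !PE; congr (_ * _)%E.
have muE B : mu B = (\sum_(k < n) \d_(iter k (@Tdbl R) p) B)%E by [].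
rewrite !muE.
have E (x : R) : \d_x (@Tdbl R @^-1` A) = \d_(Tdbl x) A :> \bar R.
  by rewrite !diracE; congr (_%:R%:E); apply/idP/idP => /set_mem h; apply/mem_set.
under eq_bigr do rewrite E.
(* Under T the orbit sum loses its first point and gains T^n p, which is that point again. *)
case: n n0 Tnp {muT nN0 P PE mu muE} => // n _ Tnp.
rewrite big_ord_recr [RHS]big_ord_recl/= addeC; congr (_ + _)%E.
by move: Tnp; rewrite iterS => ->.
Qed.

Lemma alpha_periodic c p n : (0 < n)%N -> 0 <= p < 1 -> iter n (@Tdbl R) p = p ->
  (alpha c <= (n%:R^-1)%:E * \sum_(k < n) fc c (iter k (@Tdbl R) p))%E.
Proof.
move=> n0 p01 Tnp; have [P [iP HP]] := orbit_measure n0 p01 Tnp.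
apply: ge_ereal_inf; exists (\int[P]_(x in `[0%R, 1%R[) fc c x)%E.
  by exists P.
have mN : measurable_fun setT (fun x => - fc c x)%E.
  by apply: measurableT_comp => //; exact: measurable_fc.
have HN := HP _ mN (fun x => ltac:(by rewrite oppe_ge0 fc_le0)).
have -> : (\int[P]_(x in `[0%R, 1%R[) fc c x = - \int[P]_(x in `[0%R, 1%R[) - fc c x)%E.
  rewrite -integral_ge0N; last by move=> x _; rewrite oppe_ge0 fc_le0.
  by apply: eq_integral => x _; rewrite oppeK.
rewrite HN -muleN lee_pmul2l ?lte_fin ?invr_gt0 ?ltr0n//.
under eq_bigr do rewrite -mulN1e.
rewrite -le0_sume_distrr; last by move=> k _; exact: fc_le0.
by rewrite mulN1e oppeK.
Qed.

End OrbitMeasure.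

(** * Periodic points near b and infinite alpha *)

Section AlphaNy.
Variable R : realType.
Implicit Types b c p : R.

Lemma elog_le_ln (x y : R) : 0 <= x <= y -> 0 < y -> (elog x <= (ln y)%:E)%E.
Proof.
move=> /andP[x0 xy] y0; rewrite /elog; case: eqVneq => [|x1]; first by rewrite leNye.
by rewrite lee_fin ler_ln ?posrE// lt_neqAle eq_sym x1.
Qed.

Lemma sum_le0_sub (a : nat -> \bar R) m n : (forall k, (a k <= 0)%E) -> (n < m)%N ->
  (\sum_(k < m) a k <= \sum_(1 <= k < n.+1) a k)%E.
Proof.
move=> a0 nm; rewrite -(big_mkord xpredT) (big_cat_nat (n := n.+1))//=.
rewrite big_ltn//= -[leRHS]adde0; apply: leeD.
  by rewrite -[leRHS]add0e leeD2r.
by apply: sume_le0 => k _; exact: a0.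
Qed.

(** [alpha_periodic] for an arbitrary real lift p of the periodic point, which spares later proofs
    all fractional parts. *)
Lemma alpha_le_orbit c p n (z : int) : (0 < n)%N -> 2 ^+ n * p - p = z%:~R ->
  (alpha c <= (n%:R^-1)%:E * \sum_(k < n) elog (snorm (2 ^+ k * p - (2^-1 - c))))%E.
Proof.
move=> n0 pz; pose q := frac p.
have q01 : 0 <= q < 1 by exact: frac_itv.
have qp k : exists y : int, 2 ^+ k * q = 2 ^+ k * p - y%:~R.
  exists (2 ^+ k * Num.floor p); rewrite /q /frac mulrBr intrM.
  by rewrite rmorphXn.
have Tq : iter n (@Tdbl R) q = q.
  rewrite iter_Tdbl//; have [y ->] := qp n.
  rewrite (_ : 2 ^+ n * p = p + z%:~R); last by rewrite -pz; ring.
  by rewrite -mulrNz fracDz fracDz.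
have := alpha_periodic c n0 q01 Tq.
rewrite (eq_bigr (fun k : 'I_n => elog (snorm (2 ^+ k * p - (2^-1 - c)))))// => k _.
rewrite fcE snorm_iter_Tdbl; have [y ->] := qp k.
by rewrite addrAC snormBz.
Qed.

Lemma exp2_ge2 k : (0 < k)%N -> 2 <= 2 ^+ k :> R.
Proof. by case: k => // k _; rewrite exprS ler_peMr// exprn_ege1// ler1n. Qed.

Lemma exp2B1_gt0 k : (0 < k)%N -> 0 < 2 ^+ k - 1 :> R.
Proof. by move/exp2_ge2; lra. Qed.

(** The points fixed by T^k are the fractions z / (2^k - 1); z is taken close to (2^k - 1) b. *)
Lemma periodic_near b k : (0 < k)%N -> exists p (z : int),
  2 ^+ k * p - p = z%:~R /\ (2 ^+ k - 1) * `|p - b| <= ret b k.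
Proof.
move=> k0; have e0 := exp2B1_gt0 k0.
have [z hz] := snorm_near (2 ^+ k * b - b).
exists (z%:~R / (2 ^+ k - 1)), z; split; first by field; lra.
rewrite -{1}(gtr0_norm e0) -normrM distrC in hz *.
by apply: le_trans hz; rewrite le_eqVlt; apply/orP; left; apply/eqP; congr (`|_|); field; lra.
Qed.

Lemma alpha_fast c : ~ (exists C, slow_returns (2^-1 - c) C) -> alpha c = -oo%E.
Proof.
set b := 2^-1 - c => H; apply/eqNy_ltP => M.
(* So C > 2 |M| + 2. The orbit sum is at most (2 - C k) ln 2, and ln 2 >= 1 / 2 turns this into less
   than -|M| k. *)
pose C := (Num.trunc (2 * `|M|)).+3.
have [k [k0 rk]] : exists k, (0 < k)%N /\ ret b k < 2 ^- (C * k).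
  apply: contrapT => nk; apply: H; exists C => k k0.
  by rewrite leNgt; apply/negP => h; apply: nk; exists k.
have [p [z [pz pb]]] := periodic_near b k0.
have e0 := exp2_ge2 k0.
have {}pb : snorm (p - b) <= 2 ^+ 2 * 2 ^- (C * k).
  rewrite (le_trans (snorm_le _))// -natrX ler_wpM2l// ltW// (le_lt_trans _ rk)//.
  by apply: le_trans pb; rewrite ler_peMl//; lra.
apply: (le_lt_trans (alpha_le_orbit c k0 pz)); rewrite -/b.
rewrite muleC lte_pdivrMr ?ltr0n//.
case: k k0 rk pz e0 pb => // k _ rk pz e0 pb.
rewrite big_ord_recl/= expr0 mul1r.
(* Only the term at time 0 is kept; the others are nonpositive. *)
apply: (@le_lt_trans _ _ (elog (snorm (p - b)))).
  rewrite -[leRHS]adde0 leeD2l// sume_le0// => i _.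
  by rewrite elog_le0// snorm_le1.
apply: le_lt_trans (elog_le_ln (y := 2 ^+ 2 * 2 ^- (C * k.+1)) _ _) _.
- by rewrite snorm_ge0.
- by rewrite mulr_gt0// ?invr_gt0 exprn_gt0.
rewrite lnM ?posrE ?invr_gt0 ?exprn_gt0// lnV ?posrE ?exprn_gt0// !lnXn// lte_fin.
rewrite -(mulr_natl (ln 2)) -(mulr_natl (ln 2) (_ * _)) natrM.
have l1 := @ln2_ge R.
have CM : 2 * `|M| + 2 < C%:R by have := truncnS_gt (2 * `|M|); rewrite /C -!natr1; lra.
clearbody C; have : 1 <= k.+1%:R :> R by rewrite ler1n.
move: (k.+1%:R : R) => x x1.
have MM : - `|M| <= M by rewrite lerNl -normrN ler_norm.
have hM : - `|M| * x <= M * x by rewrite ler_wpM2r//; lra.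
have h1 : (2 * `|M|) * x < (C%:R - 2) * x by rewrite ltr_pM2r; lra.
have h2 : (C%:R - 2) * x <= C%:R * x - 2 by lra.
have h3 : 0 <= `|M| * x by rewrite mulr_ge0//; lra.
have : (C%:R * x - 2) * 2^-1 <= (C%:R * x - 2) * ln 2 by rewrite ler_wpM2l//; lra.
lra.
Qed.

Lemma alpha_sum c C : slow_returns (2^-1 - c) C ->
  (forall M : R, exists n, (0 < n)%N /\ (retsum (2^-1 - c) n < (- (M * n%:R))%:E)%E) ->
  alpha c = -oo%E.
Proof.
set b := 2^-1 - c => HC HM; apply/eqNy_ltP => M.
(* The factor C + 4 is the ratio of the period to n; the added 1 pays for the ln 2 lost at each of
   the n shadowed terms. *)
have [n [n0 hn]] := HM (1 + `|M| * (C + 4)%:R).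
pose N := ((C + 4) * n)%N.
have N0 : (0 < N)%N by rewrite muln_gt0 addn4.
have nN : (n < N)%N by rewrite /N; nia.
have [p [z [pz pb]]] := periodic_near b N0.
have {}pb : `|p - b| <= 2 * 2 ^- N.
  have e0 := exp2_ge2 N0.
  rewrite ler_pdivlMr ?exprn_gt0//.
  have := ret_le1 b N; nra.
have rpos k : (0 < k)%N -> 0 < ret b k.
  by move=> k0; apply: lt_le_trans (HC k k0); rewrite invr_gt0 exprn_gt0.
apply: (le_lt_trans (alpha_le_orbit c N0 pz)); rewrite -/b.
rewrite muleC lte_pdivrMr ?ltr0n//.
have a0 k : (elog (snorm (2 ^+ k * p - b)) <= 0)%E by rewrite elog_le0// snorm_le1.
apply: (le_lt_trans (sum_le0_sub a0 nN)).
(* Since (C + 1) k + 3 <= (C + 4) n, the gap between 2^k p and 2^k b is at most the k-th return, so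
   the distance to b at most doubles. *)
have le2 k : (0 < k < n.+1)%N -> (elog (snorm (2 ^+ k * p - b)) <= (ln 2 + ln (ret b k))%:E)%E.
  move=> /andP[k0 kn]; rewrite -lnM ?posrE ?rpos//.
  apply: elog_le_ln; last by rewrite mulr_gt0// rpos.
  rewrite snorm_ge0/= (_ : 2 ^+ k * p - b = 2 ^+ k * (p - b) + (2 ^+ k * b - b)); last by ring.
  rewrite (le_trans (ler_snormD _ _))// -/(ret b k) mulr_natl mulr2n lerD2r.
  apply: le_trans (HC k k0); rewrite (le_trans (ler_snormM2 _ _))//.
  apply: (@le_trans _ _ (2 ^+ k * (2 ^+ 3 * 2 ^- N))).
    rewrite ler_wpM2l ?exprn_ge0// (le_trans (snorm_le _))//.
    by rewrite (_ : 2 ^+ 3 * 2 ^- N = 4 * (2 * 2 ^- N)) ?ler_wpM2l//; ring.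
  rewrite mulrA -exprD ler_pdivrMr ?exprn_gt0// mulrC ler_pdivlMr ?exprn_gt0// -exprD.
  by rewrite ler_eXn2l ?ltr1n// /N; nia.
rewrite big_nat (le_lt_trans (lee_sum _ le2))// -big_nat sumEFin.
rewrite big_split/= -/(logsum b n).
move: hn; rewrite retsumE; last by move=> k /andP[k0 _]; rewrite gt_eqF// rpos.
rewrite !lte_fin sumr_const_nat subn1/= -(mulr_natl (ln 2)) => hn.
have : n%:R * ln 2 <= n%:R * 1 :> R by rewrite ler_wpM2l// ln2_le1.
have MM : - `|M| <= M by rewrite lerNl -normrN ler_norm.
have : - `|M| * N%:R <= M * N%:R by rewrite ler_wpM2r.
rewrite /N natrM; lra.
Qed.

End AlphaNy.

(** * Shadowing and the lower bound on alpha *)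

Section Shadowing.
Variable R : realType.
Implicit Types b c x : R.

Lemma slow_ret_gt0 b C : slow_returns b C -> forall k, (0 < k)%N -> 0 < ret b k.
Proof. by move=> HC k k0; apply: lt_le_trans (HC k k0); rewrite invr_gt0 exprn_gt0. Qed.

(** In t steps the gap x - b grows by a factor of at most 2^t, and t + 1 + C t <= (C + 2) i keeps it
    below half of the return. *)
Lemma shadow b C x i t : slow_returns b C -> snorm (x - b) <= 2 ^- ((C + 2) * i) ->
  (0 < t <= i)%N -> ret b t / 2 <= snorm (2 ^+ t * x - b).
Proof.
move=> HC hx /andP[t0 ti].
have : snorm (2 ^+ t * (x - b)) <= ret b t / 2.
  apply: (le_trans (ler_snormM2 _ _)); rewrite ler_pdivlMr//.
  apply: le_trans (HC t t0).
  apply: (@le_trans _ _ (2 ^+ t.+1 * 2 ^- ((C + 2) * i))).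
    by rewrite exprS mulrC mulrA ler_wpM2l// mulr_ge0// exprn_ge0.
  rewrite ler_pdivrMr ?exprn_gt0// mulrC ler_pdivlMr ?exprn_gt0// -exprD.
  by rewrite ler_eXn2l ?ltr1n//; nia.
have := ler_snormB (2 ^+ t * b - b) (2 ^+ t * (b - x)).
rewrite -[snorm (2 ^+ t * (b - x))]snormN.
rewrite (_ : 2 ^+ t * b - b - 2 ^+ t * (b - x) = 2 ^+ t * x - b); last by ring.
rewrite (_ : - (2 ^+ t * (b - x)) = 2 ^+ t * (x - b)); last by ring.
by rewrite -/(ret b t); lra.
Qed.

Lemma shadow_sum b C x i n : slow_returns b C -> snorm (x - b) <= 2 ^- ((C + 2) * i) ->
  (n <= i)%N ->
  \sum_(1 <= t < n.+1) - ln (snorm (2 ^+ t * x - b)) <= - logsum b n + n%:R.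
Proof.
move=> HC hx ni.
have -> : - logsum b n + n%:R = \sum_(1 <= t < n.+1) (1 - ln (ret b t)).
  by rewrite big_split/= sumr_const_nat subn1 sumrN addrC.
rewrite big_nat [leRHS]big_nat; apply: ler_sum => t /andP[t0 tn].
have r0 := slow_ret_gt0 HC t0.
have h := @shadow _ _ _ _ t HC hx; rewrite t0 (leq_trans _ ni)// in h.
have {}h := h isT.
have h2 : 0 < ret b t / 2 by rewrite divr_gt0.
have : ln (ret b t / 2) <= ln (snorm (2 ^+ t * x - b)).
  by rewrite ler_ln ?posrE// (lt_le_trans h2).
by rewrite ln_div ?posrE//; have := @ln2_le1 R; lra.
Qed.

(** The truncation of -f_c at height K ln 2. *)
Definition hcut b (K : nat) x : R := - ln (Num.max (snorm (x - b)) (2 ^- K)).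

Lemma exp2V_gt0 n : 0 < 2 ^- n :> R.
Proof. by rewrite invr_gt0 exprn_gt0. Qed.
Hint Resolve exp2V_gt0 : core.

Lemma ln_exp2V n : ln (2 ^- n : R) = - (n%:R * ln 2).
Proof. by rewrite lnV ?posrE ?exprn_gt0// lnXn// -(mulr_natl (ln 2)). Qed.

Lemma max_cut_gt0 b K x : 0 < Num.max (snorm (x - b)) (2 ^- K).
Proof. by rewrite lt_max exp2V_gt0 orbT. Qed.
Hint Resolve max_cut_gt0 : core.

Lemma hcut_ge0 b K x : 0 <= hcut b K x.
Proof.
rewrite oppr_ge0 ln_le0// ge_max snorm_le1/= invf_le1 ?exprn_gt0//.
by rewrite exprn_ege1// ler1n.
Qed.

Lemma hcut_le b K x y : 0 < y -> y <= Num.max (snorm (x - b)) (2 ^- K) ->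
  hcut b K x <= - ln y.
Proof. by move=> y0 h; rewrite lerN2 ler_ln ?posrE. Qed.

Lemma hcut_leK b K x : hcut b K x <= K%:R.
Proof.
apply: le_trans (@hcut_le _ _ _ (2 ^- K) _ _) _; rewrite ?le_max ?lexx ?orbT//.
rewrite ln_exp2V opprK -[leRHS]mulr1 ler_wpM2l//; exact: ln2_le1.
Qed.

(* The cost [-ln |sin|] of an approach to [b] at scale [2 ^ - (C + 2) i] is
   amortized over the [i] steps during which the orbit shadows that of [b]. *)
Lemma hcut_block b C A K x : (0 < K)%N -> slow_returns b C ->
  (forall n, - logsum b n <= A%:R * n%:R) ->
  exists L, (0 < L <= K)%N /\
   \sum_(0 <= t < L) hcut b K (2 ^+ t * x) <= (2 * (C + 2) + A + 1)%:R * L%:R.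
Proof.
move=> K0 HC HA.
(* The cap at K makes a largest i exist even for x = b; beyond it the truncation bounds the cost. *)
pose P i := (i <= K)%N && (snorm (x - b) <= 2 ^- ((C + 2) * i)).
have P0 : exists i, P i by exists 0; rewrite /P muln0 expr0 invr1 snorm_le1.
have PK i : P i -> (i <= K)%N by case/andP.
case: (ex_maxnP P0 PK) => i /andP[iK hi] imax.
have cost : hcut b K x <= ((C + 2) * i.+1)%:R.
  have [iK'|iK'] := eqVneq i K.
    by rewrite (le_trans (hcut_leK _ _ _))// ler_nat iK'; nia.
  have hS : 2 ^- ((C + 2) * i.+1) <= Num.max (snorm (x - b)) (2 ^- K).
    rewrite le_max; apply/orP; left; rewrite leNgt; apply/negP => h.
    have /imax : P i.+1 by rewrite /P (ltW h) andbT ltn_neqAle iK' iK.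
    by rewrite ltnn.
  rewrite (le_trans (hcut_le _ hS))// ln_exp2V opprK -[leRHS]mulr1 ler_wpM2l//.
  exact: ln2_le1.
(* If i = 0 there is no shadowing, and the block is the current step alone. *)
exists (maxn i 1); split; first by rewrite leq_max orbT geq_max iK.
rewrite big_ltn ?leq_max ?orbT// expr0 mul1r.
have [iz|i0] := posnP i.
  by rewrite iz in cost; rewrite iz max0n big_geq// addr0 mulr1 (le_trans cost)// ler_nat; lia.
rewrite (maxn_idPl i0).
case: i i0 iK hi cost imax => // j _ jK hj cost _.
apply: (@le_trans _ _ (((C + 2) * j.+2)%:R + (A%:R * j%:R + j%:R))).
  apply: lerD => //.
  apply: le_trans (@le_trans _ _ _ _ _ (shadow_sum HC hj (leqnSn j)) _); last first.
    by rewrite lerD2r.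
  rewrite big_nat [leRHS]big_nat; apply: ler_sum => t /andP[t0 tn].
  apply: hcut_le; last by rewrite le_max lexx.
  apply: lt_le_trans (shadow HC hj (t := t) _); first by rewrite divr_gt0// (slow_ret_gt0 HC).
  by rewrite t0 (ltnW tn).
rewrite -!natrM -!natrD ler_nat; nia.
Qed.

(** The orbit is cut greedily into the blocks of [hcut_block]. What remains at the end has at most K
    terms, each at most K. *)
Lemma hcut_sum b C A K n x : (0 < K)%N -> slow_returns b C ->
  (forall n, - logsum b n <= A%:R * n%:R) ->
  \sum_(0 <= t < n) hcut b K (2 ^+ t * x) <=
    (2 * (C + 2) + A + 1)%:R * n%:R + (K * K)%:R.
Proof.
move=> K0 HC HA; elim/ltn_ind: n x => n IH x.
have [nK|Kn] := leqP n K.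
  apply: (@le_trans _ _ (\sum_(0 <= t < n) K%:R)).
    by apply: ler_sum => t _; exact: hcut_leK.
  rewrite sumr_const_nat subn0 -[leLHS]mulr_natr -!natrM -natrD ler_nat; nia.
have [L [/andP[L0 LK] hL]] := hcut_block x K0 HC HA.
rewrite (big_cat_nat (n := L))//=; last by rewrite (leq_trans LK)// ltnW.
have nL : (n - L < n)%N by lia.
rewrite [X in _ + X](_ : _ = \sum_(0 <= t < n - L) hcut b K (2 ^+ t * (2 ^+ L * x))).
  apply: le_trans (lerD hL (IH _ nL (2 ^+ L * x))) _.
  by rewrite addrA -mulrDr -natrD subnKC// ltnW// (leq_ltn_trans LK).
by rewrite -{1}[L]add0n big_addn; apply: eq_bigr => t _; rewrite mulrA -exprD.
Qed.

Lemma measurable_Tdbl : measurable_fun [set: R] (@Tdbl R).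
Proof.
rewrite (_ : @Tdbl R = (frac : R -> R) \o (fun x => 2 * x))//.
apply: measurableT_comp; last exact: mulrl_measurable.
apply: measurable_funB; first exact: measurable_id.
apply: nondecreasing_measurable => // x y xy.
by rewrite ler_int le_floor.
Qed.

Lemma invariant_integral (P : probability R R) (h : R -> \bar R) t :
  invariant_prob P -> measurable_fun setT h -> (forall x, (0 <= h x)%E) ->
  (\int[P]_x h (iter t (@Tdbl R) x) = \int[P]_x h x)%E.
Proof.
move=> [_ iP] mh h0; elim: t => [//|t IH].
rewrite -IH.
have mt : measurable_fun setT (h \o iter t (@Tdbl R)).
  apply: measurableT_comp => //; elim: t {IH} => [|t IHt]; first exact: measurable_id.
  by rewrite (_ : iter t.+1 _ = @Tdbl R \o iter t (@Tdbl R))//;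
    apply: measurableT_comp => //; exact: measurable_Tdbl.
under eq_integral do rewrite iterSr.
have := ge0_integral_pushforward measurable_Tdbl P measurableT mt (fun x _ => h0 _).
rewrite preimage_setT => <-.
apply: eq_measure_integral => [|mT A mA _]; [exact: measurable_Tdbl|exact: iP].
Qed.

End Shadowing.

(** * Integration of the truncations *)

Section AlphaFinite.
Variable R : realType.
Implicit Types b c x : R.

Lemma measurable_hcut b K : measurable_fun [set: R] (hcut b K).
Proof.
apply: measurable_funN; apply: (@measurableT_comp _ _ _ _ _ _ (@ln R)).
  exact: measurable_ln.
apply: measurable_maxr => //; apply: measurableT_comp; first exact: measurable_snorm.
exact: measurable_funB.
Qed.

Lemma hcut_Tdbl b K t x : hcut b K (iter t (@Tdbl R) x) = hcut b K (2 ^+ t * x).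
Proof. by rewrite /hcut snorm_iter_Tdbl. Qed.

(** By invariance, n times the integral is the integral of a Birkhoff sum of length n. Dividing by n
    and letting n grow removes the term K^2, so the bound is independent of K. *)
Lemma integral_hcut (P : probability R R) b C A K : invariant_prob P ->
  (0 < K)%N -> slow_returns b C -> (forall n, - logsum b n <= A%:R * n%:R) ->
  (\int[P]_x (hcut b K x)%:E <= (2 * (C + 2) + A + 1)%:R%:E)%E.
Proof.
move=> iP K0 HC HA; set B := (2 * (C + 2) + A + 1)%N.
have mh : measurable_fun setT (EFin \o hcut b K).
  by apply/measurable_EFinP; exact: measurable_hcut.
have h0 x : (0 <= (EFin \o hcut b K) x)%E by rewrite lee_fin hcut_ge0.
have mT t : measurable_fun setT (iter t (@Tdbl R)).
  elim: t => [|t IHt]; first exact: measurable_id.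
  by rewrite (_ : iter t.+1 _ = @Tdbl R \o iter t (@Tdbl R))//;
    apply: measurableT_comp => //; exact: measurable_Tdbl.
set u := (\int[P]_x _)%E.
have key n : (n%:R%:E * u <= (B%:R * n%:R + (K * K)%:R)%:E)%E.
  have -> : (n%:R%:E * u = \int[P]_x \sum_(0 <= t < n) (hcut b K (iter t (@Tdbl R) x))%:E)%E.
    rewrite ge0_integral_sum//; first last.
    - by move=> t x _; exact: h0.
    - by move=> t; apply: (measurableT_comp mh (mT t)).
    under eq_bigr => t _ do rewrite (invariant_integral t iP mh h0).
    rewrite -/u; elim: n => [|n IHn]; first by rewrite big_geq// mul0e.
    rewrite big_nat_recr//= -IHn -natr1 EFinD ge0_muleDl ?mul1e// lee_fin.
  rewrite (@le_trans _ _ (\int[P]_x (B%:R * n%:R + (K * K)%:R)%:E)%E)//.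
    apply: ge0_le_integral => //.
    - by move=> x _; apply: sume_ge0 => t _; exact: h0.
    - by apply: emeasurable_sum => t _; apply: (measurableT_comp mh (mT t)).
    - move=> x _; rewrite sumEFin lee_fin.
      under eq_bigr do rewrite hcut_Tdbl.
      exact: hcut_sum.
  by rewrite integral_cst//= probability_setT mule1.
have u0 : (0 <= u)%E by apply: integral_ge0 => x _; exact: h0.
case: u u0 key => [r| |//] r0 key; last by have := key 1%N; rewrite mul1e.
rewrite lee_fin; apply/ler_addgt0Pr => e e0.
pose n := (Num.trunc ((K * K)%:R / e)).+1.
have n0 : 0 < n%:R :> R by rewrite ltr0n.
have := key n; rewrite -EFinM lee_fin => h.
have : (K * K)%:R < e * n%:R.
  by rewrite mulrC -ltr_pdivrMr// truncnS_gt.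
by move: h; rewrite -(ler_pM2l n0); nra.
Qed.

Lemma cvg_hcut c x : (hcut (2^-1 - c) n.+1 x)%:E @[n --> \oo] --> (- fc c x)%E.
Proof.
rewrite fcE /hcut /elog; set y := snorm _.
have [->|y0] := eqVneq y 0.
  rewrite /=; apply/cvgeryP/cvgryPge => M.
  exists (Num.trunc (2 * `|M|)) => // n /= hn.
  rewrite max_r ?invr_ge0 ?exprn_ge0// ln_exp2V opprK.
  have := truncnS_gt (2 * `|M|); have := @ln2_ge R; have := ler_norm M.
  have : (Num.trunc (2 * `|M|)).+1%:R <= n.+1%:R :> R by rewrite ler_nat.
  have := ler_wpM2l (ler0n R n.+1) (@ln2_ge R).
  move: (n.+1%:R : R) => X; move: ((Num.trunc _).+1%:R : R) => Y; lra.
have yp : 0 < y by rewrite lt_neqAle eq_sym y0 snorm_ge0.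
apply: cvg_near_cst; exists (Num.trunc y^-1) => // n /= hn.
rewrite max_l// invf_ple ?posrE ?exprn_gt0//.
apply: le_trans (ltW (truncnS_gt y^-1)) _.
by rewrite -natrX ler_nat (leq_trans _ (ltnW (ltn_expl _ _))).
Qed.

(** Monotone convergence in K transfers the uniform bound of [integral_hcut] to -f_c. *)
Lemma alpha_gtNy c C A : slow_returns (2^-1 - c) C ->
  (forall n, - logsum (2^-1 - c) n <= A%:R * n%:R) -> (-oo < alpha c)%E.
Proof.
move=> HC HA; set b := 2^-1 - c in HC HA.
apply: (@lt_le_trans _ _ (- (2 * (C + 2) + A + 1)%:R%:E)%E); first exact: ltNyr.
apply: le_ereal_inf_tmp => _ [P [iP ->]].
have mN : measurable_fun setT (fun x => - fc c x)%E.
  by apply: measurableT_comp => //; exact: measurable_fc.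
have f0 x : (0 <= - fc c x)%E by rewrite oppe_ge0 fc_le0.
have -> : (\int[P]_(x in `[0%R, 1%R[) fc c x = - \int[P]_(x in `[0%R, 1%R[) - fc c x)%E.
  by rewrite -integral_ge0N//; apply: eq_integral => x _; rewrite oppeK.
rewrite leeN2; apply: (@le_trans _ _ (\int[P]_x - fc c x)%E).
  exact: ge0_subset_integral.
have -> : (\int[P]_x - fc c x = \int[P]_x limn (fun n => (hcut b n.+1 x)%:E))%E.
  by apply: eq_integral => x _; apply/esym/cvg_lim => //; exact: cvg_hcut.
rewrite monotone_convergence//; first last.
- move=> x _ m n mn; rewrite lee_fin /hcut lerN2 ler_ln ?posrE ?max_cut_gt0//.
  rewrite le_max2// lef_pV2 ?posrE ?exprn_gt0// ler_eXn2l// ?ltr1n//.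
- by move=> n x _; rewrite lee_fin hcut_ge0.
- by move=> n; apply/measurable_EFinP; exact: measurable_hcut.
apply: lime_le; last by apply: nearW => n; exact: integral_hcut.
apply: ereal_nondecreasing_is_cvgn => m n mn; apply: ge0_le_integral => //.
- by move=> x _; rewrite lee_fin hcut_ge0.
- by apply/measurable_EFinP; exact: measurable_hcut.
- by apply/measurable_EFinP; exact: measurable_hcut.
- move=> x _; rewrite lee_fin /hcut lerN2 ler_ln ?posrE ?max_cut_gt0//.
  rewrite le_max2// lef_pV2 ?posrE ?exprn_gt0// ler_eXn2l// ?ltr1n//.
Qed.

End AlphaFinite.

(** * Statements (1) to (4) *)

Section Parts.
Variable R : realType.
Implicit Types b c x : R.

Lemma alpha_mstar c : alpha c = -oo%E <-> mstar c = -oo%E.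
Proof.
split=> [aN|/mstar_eqNy HM].
  apply/eqP; apply: contraT => /mstar_neqNy[A [pos HA]].
  have [C HC] := logsum_slow pos HA.
  by have := alpha_gtNy HC HA; rewrite aN ltxx.
have [[C HC]|] := pselect (exists C, slow_returns (2^-1 - c) C).
  exact: alpha_sum HC HM.
exact: alpha_fast.
Qed.

Lemma alpha_slow c : alpha c <> -oo%E -> exists C, slow_returns (2^-1 - c) C.
Proof. by move=> aN; apply: contrapT => H; apply: aN; exact: alpha_fast. Qed.

Lemma snorm_fracM k b y : snorm (2 ^+ k * frac b - y) = snorm (2 ^+ k * b - y).
Proof.
rewrite /Defs.frac mulrBr addrAC.
by rewrite (_ : 2 ^+ k * (Num.floor b)%:~R = (2 ^+ k * Num.floor b)%:~R) ?snormBz// intrM rmorphXn.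
Qed.

Lemma ret_iter k b : ret b k = snorm (iter k (@Tdbl R) (frac b) - b).
Proof. by rewrite snorm_iter_Tdbl snorm_fracM. Qed.

Lemma ret_eq0 k b : (ret b k == 0) = (iter k (@Tdbl R) (frac b) == frac b).
Proof.
apply/eqP/eqP => [/snorm_eq0[z hz]|h].
  rewrite iter_Tdbl ?frac_itv//.
  rewrite (_ : 2 ^+ k * frac b = b + (z - 2 ^+ k * Num.floor b)%:~R) ?fracDz//.
  by rewrite intrB intrM rmorphXn/= -hz /Defs.frac; ring.
by rewrite ret_iter h snorm_frac subrr snorm0.
Qed.

Lemma alpha_periodic_pt c : periodic_pt (2^-1 - c) -> alpha c = -oo%E.
Proof.
move=> [n [n0 Tn]]; apply/alpha_mstar/mstar_eqNy => M; exists n; split => //.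
by rewrite (@retsum_Ny _ _ n) ?ltNyr ?n0 ?leqnn//; apply/eqP; rewrite ret_eq0 Tn.
Qed.

(** The returns are eventually periodic in k and never 0, so they have a positive lower bound d, and
    the n-th sum is at least n ln d. *)
Lemma alpha_preperiodic_pt c : preperiodic_pt (2^-1 - c) ->
  ~ periodic_pt (2^-1 - c) -> (-oo < alpha c)%E.
Proof.
set b := 2^-1 - c => -[m [n [n0 Tn]]] np.
rewrite ltNye; apply/eqP => /alpha_mstar/mstar_eqNy HM.
have pos k : (0 < k)%N -> ret b k != 0.
  by move=> k0; rewrite ret_eq0; apply/eqP => h; apply: np; exists k.
have m0 : (0 < m)%N.
  by rewrite lt0n; apply/eqP => mz; apply: np; exists n; move: Tn; rewrite mz/= frac_id ?frac_itv.
have {}Tn k : (m <= k)%N -> ret b (k + n) = ret b k.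
  move=> mk; rewrite !ret_iter; congr (snorm (_ - _)).
  have -> : (k + n = (k - m) + (n + m))%N by lia.
  rewrite -{2}(subnK mk) !iterD; congr (iter _ _ _).
  by move: Tn; rewrite (iter_Tdbl m (frac_itv b)) frac_id ?frac_itv.
pose d := \big[Num.min/1]_(1 <= k < m + n) ret b k.
have d0 : 0 < d.
  rewrite /d big_nat; apply: (big_ind (fun x : R => 0 < x)) => //.
    by move=> x y x0 y0; rewrite lt_min x0.
  by move=> k /andP[k0 _]; rewrite lt_neqAle ret_ge0 andbT eq_sym pos.
have dle k : (0 < k)%N -> d <= ret b k.
  elim/ltn_ind: k => k IH k0; have [kmn|mnk] := ltnP k (m + n).
    by rewrite /d (bigD1_seq k) ?iota_uniq ?mem_index_iota ?k0//= ge_min lexx.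
  have nk : (n <= k)%N by apply: leq_trans mnk; rewrite leq_addl.
  rewrite -(subnK nk) Tn; last by rewrite leq_subRL// addnC.
  apply: IH; first by rewrite ltn_subrL n0.
  by rewrite subn_gt0; apply: leq_trans mnk; rewrite -[X in (X < _)%N]add0n ltn_add2r.
have [N [N0]] := HM (- ln d).
rewrite retsumE; last by move=> k /andP[k0 _]; exact: pos.
rewrite lte_fin ltNge mulNr opprK => /negP; apply.
have -> : ln d * N%:R = \sum_(1 <= k < N.+1) ln d.
  by rewrite sumr_const_nat subn1 mulr_natr.
rewrite /logsum big_nat [leRHS]big_nat; apply: ler_sum => k /andP[k0 _].
by rewrite ler_ln ?posrE// ?dle// (lt_le_trans d0)// dle.
Qed.

(** Every ball contains a parameter whose b is k-periodic, for k large. Near that parameter the k-th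
    return is below 2^-(C k), so a smaller ball misses the set. *)
Lemma nowhere_dense_slow C : nowhere_dense [set c : R | slow_returns (2^-1 - c) C].
Proof.
rewrite /nowhere_dense -subset0 => x /nbhs_ballP[e /= e0 hball].
pose k := (Num.trunc (2 / e)).+1.
have k2 : 2 / e < 2 ^+ k.
  apply: lt_le_trans (truncnS_gt _) _.
  by rewrite -natrX ler_nat ltnW// ltn_expl.
have [p [z [pz pb]]] := periodic_near (2^-1 - x) (ltn0Sn (Num.trunc (2 / e))).
rewrite -/k in pz pb.
have e2 := @exp2_ge2 R k isT.
have {}pb : `|p - (2^-1 - x)| < e.
  have r1 := ret_le1 (2^-1 - x) k.
  have : `|p - (2^-1 - x)| * 2 ^+ k <= 2.
    have := normr_ge0 (p - (2^-1 - x)); nra.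
  rewrite -ler_pdivlMr ?exprn_gt0// => /le_lt_trans; apply.
  by rewrite ltr_pdivrMr ?exprn_gt0// mulrC -ltr_pdivrMr.
have /hball : ball x e (2^-1 - p).
  by rewrite /ball/= distrC (_ : 2^-1 - p - x = - (p - (2^-1 - x))) ?normrN//; ring.
pose eta : R := 2 ^- (C * k + k + 3).
have eta0 : 0 < eta by rewrite invr_gt0 exprn_gt0.
move=> /(_ (ball (2^-1 - p) eta)) []; first exact: nbhsx_ballx.
move=> c [/= /(_ k isT) + hc].
rewrite leNgt => /negP; apply; rewrite /ret.
rewrite (_ : 2 ^+ k * (2^-1 - c) - (2^-1 - c) = (2 ^+ k - 1) * (2^-1 - p - c) + z%:~R); last first.
  by rewrite -pz; ring.
rewrite snormDz; apply: le_lt_trans (snorm_le _) _.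
rewrite normrM gtr0_norm ?exp2B1_gt0//.
have hc' : `|2^-1 - p - c| < eta by [].
apply: (@lt_le_trans _ _ (2 ^+ 2 * (2 ^+ k * eta))).
  rewrite (_ : 2 ^+ 2 = 4) ?ltr_pM2l//; last by ring.
  have := normr_ge0 (2^-1 - p - c); nra.
rewrite mulrA -exprD /eta ler_pdivrMr ?exprn_gt0// mulrC ler_pdivlMr ?exprn_gt0// -exprD.
by rewrite ler_eXn2l ?ltr1n//; lia.
Qed.

Lemma first_category_alpha : first_category (`[0, 1[ `\` [set c : R | alpha c = -oo%E]).
Proof.
exists (fun C => [set c | slow_returns (2^-1 - c) C]); split; first exact: nowhere_dense_slow.
by move=> c [_ /alpha_slow[C HC]]; exists C.
Qed.

End Parts.

(** * Null sets for Hausdorff measures *)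

Section HausdorffNull.
Variable R : realType.
Implicit Types (s : R) (S : set R).

Definition covers (L : nat -> seq (R * R)) S :=
  forall x, S x -> exists n p, p \in L n /\ `|x - p.1| <= p.2.

(** A pair is the centre and radius of an interval, and intervals are grouped into finite lists, one
    per level. The small diameters demanded by [hausdorff_delta] come from the smallness of the
    sum. *)
Definition hnull s S := forall e, 0 < e -> exists L : nat -> seq (R * R),
  [/\ covers L S, forall n p, p \in L n -> 0 <= p.2 &
      forall N, \sum_(0 <= n < N) \sum_(p <- L n) p.2 `^ s <= e].

Lemma hnullS s S S' : S `<=` S' -> hnull s S' -> hnull s S.
Proof.
move=> SS' H e e0; have [L [cL L0 sL]] := H e e0.
by exists L; split => // x /SS'; exact: cL.
Qed.

Lemma hnull_reflect s S (a : R) : hnull s S -> hnull s [set c | S (a - c)].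
Proof.
move=> H e e0; have [L [cL L0 sL]] := H e e0.
exists (fun n => [seq (a - p.1, p.2) | p <- L n]); split => [c /cL[n [p [pL hp]]]|n p|N].
- exists n, (a - p.1, p.2); split; first by apply/mapP; exists p.
  by rewrite /= (_ : c - _ = - (a - c - p.1)) ?normrN//; ring.
- by move=> /mapP[q qL ->]; exact: L0 qL.
- by under eq_bigr do rewrite big_map; exact: sL.
Qed.

Lemma sum_triangle (F : nat -> nat -> R) N :
  \sum_(0 <= n < N) \sum_(0 <= j < n.+1) F j (n - j)%N =
  \sum_(0 <= j < N) \sum_(0 <= i < N - j) F j i.
Proof.
elim: N => [|N IH]; first by rewrite !big_geq.
rewrite big_nat_recr//= IH [RHS]big_nat_recr//= subSn// subnn big_nat1.
rewrite [X in _ + X]big_nat_recr//= subnn addrA; congr (_ + _).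
rewrite -big_split/= big_nat [RHS]big_nat; apply: eq_bigr => j /andP[_ jN].
by rewrite subSn 1?ltnW// big_nat_recr.
Qed.

Lemma sum_half_lt1 N : \sum_(0 <= j < N) 2 ^- j.+1 <= 1 :> R.
Proof.
suff -> : \sum_(0 <= j < N) 2 ^- j.+1 = 1 - 2 ^- N :> R.
  by rewrite lerBlDr lerDl invr_ge0 exprn_ge0.
elim: N => [|N IH]; first by rewrite big_geq// expr0 invr1 subrr.
rewrite big_nat_recr//= IH exprS invfM.
by field.
Qed.

(** The j-th set gets the budget e / 2^(j + 1), and the lists are merged along antidiagonals. *)
Lemma hnull_bigcup s (S : nat -> set R) : (forall j, hnull s (S j)) ->
  hnull s (\bigcup_j S j).
Proof.
move=> H e e0.
have /choice[L HL] : forall j, exists L : nat -> seq (R * R),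
  [/\ covers L (S j), forall n p, p \in L n -> 0 <= p.2 &
      forall N, \sum_(0 <= n < N) \sum_(p <- L n) p.2 `^ s <= e * 2 ^- j.+1].
  by move=> j; apply: H; rewrite mulr_gt0// invr_gt0 exprn_gt0.
exists (fun n => flatten [seq L j (n - j)%N | j <- index_iota 0 n.+1]); split => [x [j _ Sx]|n p|N].
- have [cL _ _] := HL j; have [n [p [pL hp]]] := cL x Sx.
  exists (j + n)%N, p; split => //; apply/flatten_mapP; exists j.
    by rewrite mem_index_iota ltnS leq_addr.
  by rewrite addKn.
- by move=> /flatten_mapP[j _ pL]; have [_ L0 _] := HL j; exact: L0 pL.
under eq_bigr do rewrite big_flatten big_map.
rewrite (sum_triangle (fun j i => \sum_(p <- L j i) p.2 `^ s)).
apply: (@le_trans _ _ (\sum_(0 <= j < N) e * 2 ^- j.+1)).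
  by apply: ler_sum => j _; have [_ _] := HL j; exact.
rewrite -mulr_sumr -[leRHS]mulr1; apply: ler_wpM2l; [exact: ltW|exact: sum_half_lt1].
Qed.

Definition cball (a r : R) : set R := [set x | `|x - a| <= r].

Lemma diam_ball (a r : R) : 0 <= r ->
  (0 <= diam (cball a r) <= (2 * r)%:E)%E.
Proof.
move=> r0; apply/andP; split; first by apply: ereal_sup_ubound; left.
apply: ge_ereal_sup => _ [->|[x xa [y ya <-]]]; first by rewrite lee_fin mulr_ge0.
rewrite lee_fin (_ : x - y = (x - a) - (y - a)); last by ring.
apply: le_trans (ler_normB _ _) _.
by rewrite mulr_natl mulr2n lerD.
Qed.

Lemma diam_pow_ball s (a r : R) : 0 < s -> 0 <= r ->
  diam_pow s (cball a r) <= (2 * r) `^ s.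
Proof.
move=> s0 r0; rewrite /diam_pow; case: ifPn => _; first exact: powR_ge0.
have /andP[d0 d1] := diam_ball a r0.
have dfin : diam (cball a r) \is a fin_num.
  by rewrite ge0_fin_numE// (le_lt_trans d1)// ltry.
have h : fine (diam (cball a r)) <= 2 * r by rewrite -lee_fin fineK.
by apply: ge0_ler_powR h; rewrite ?nnegrE ?(ltW s0) ?fine_ge0 ?mulr_ge0.
Qed.

Lemma hausdorff_measure_hnull s S : 0 < s -> hnull s S -> hausdorff_measure s S = 0%E.
Proof.
move=> s0 H; apply/eqP; rewrite eq_le; apply/andP; split; last first.
  apply: le_ereal_sup_tmp; exists (hausdorff_delta s 1 S); first by exists (1 : R) => //=; exact: ltr01.
  apply: le_ereal_inf_tmp => _ [U [_ [_ ->]]].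
  apply: nneseries_ge0 => n _ _; rewrite lee_fin /diam_pow.
  by case: ifPn => // _; exact: powR_ge0.
apply: ge_ereal_sup => _ [d /= d0 <-].
apply/lee_addgt0Pr => e e0; rewrite add0e.
have p2 : 0 < 2 `^ s :> R by rewrite powR_gt0.
(* The first bound absorbs the 2^s from radius to diameter; the second forces every radius below d /
   2. *)
have [|L [cL L0 sL]] := H (Num.min (e / 2 `^ s) ((d / 2) `^ s)).
  by rewrite lt_min divr_gt0//= powR_gt0// divr_gt0.
(* A ball of radius 0, free of charge since s > 0, makes each list nonempty. Hence the first k + 1
   lists together have a k-th entry, and [u] enumerates all the balls. *)
pose L' n := (0, 0) :: L n.
pose flat n := flatten [seq L' j | j <- index_iota 0 n.+1].
have flatS n : flat n.+1 = flat n ++ L' n.+1.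
  by rewrite /flat /index_iota !subn0 -(addn1 n.+1) iotaD map_cat flatten_cat/= cats0.
have flat_le m n : (m <= n)%N -> exists t, flat n = flat m ++ t.
  move/subnK => <-; elim: (n - m)%N => [|j [t IH]]; first by exists [::]; rewrite cats0.
  by exists (t ++ L' (j + m).+1); rewrite addSn flatS IH catA.
have flat_size n : (n < size (flat n))%N.
  elim: n => [//|n IH]; rewrite flatS size_cat/= addnS ltnS.
  by rewrite (leq_trans IH)// leq_addr.
pose u k := nth (0, 0) (flat k) k.
have uE m k : (k < size (flat m))%N -> nth (0, 0) (flat m) k = u k.
  move=> km; rewrite /u; have [mk|/ltnW mk] := leqP m k.
    by have [t ->] := flat_le _ _ mk; rewrite nth_cat km.
  by have [t ->] := flat_le _ _ mk; rewrite nth_cat flat_size.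
have flat0 n p : p \in flat n -> 0 <= p.2.
  by move=> /flatten_mapP[j _]; rewrite inE => /orP[/eqP->//|]; exact: L0.
have u0 k : 0 <= (u k).2 by apply: (flat0 k); apply: mem_nth.
have flat_sum n : \sum_(p <- flat n) p.2 `^ s = \sum_(0 <= j < n.+1) \sum_(p <- L j) p.2 `^ s.
  rewrite big_flatten big_map; apply: eq_bigr => j _.
  by rewrite big_cons/= powR0 ?gt_eqF// add0r.
have usum K : \sum_(0 <= k < K) (u k).2 `^ s <= Num.min (e / 2 `^ s) ((d / 2) `^ s).
  apply: le_trans (sL K.+1); rewrite -flat_sum.
  rewrite -(cat_take_drop K (flat K)) big_cat/=.
  rewrite -[leLHS]addr0; apply: lerD; last first.
    by apply: sumr_ge0 => p _; exact: powR_ge0.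
  rewrite (big_nth (0, 0)) size_take flat_size big_nat [leRHS]big_nat.
  by apply: ler_sum => k /andP[_ kK]; rewrite nth_take// uE// (ltn_trans kK).
have ule k : (u k).2 <= d / 2.
  rewrite leNgt; apply/negP => h.
  have : (d / 2) `^ s < (u k).2 `^ s.
    by apply: gt0_ltr_powR => //; rewrite nnegrE ?divr_ge0 ?(ltW d0).
  rewrite ltNge => /negP; apply; have := usum k.+1.
  rewrite le_min big_nat_recr//= => /andP[_]; apply: le_trans.
  by rewrite lerDr; apply: sumr_ge0 => p _; exact: powR_ge0.
apply: ge_ereal_inf.
exists (\sum_(0 <= k <oo) (diam_pow s (cball (u k).1 (u k).2))%:E)%E.
  exists (fun k => (cball (u k).1 (u k).2)); split; last split => //.
    move=> x /cL[n [p [pL hp]]].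
    have pf : p \in flat n.
      by apply/flatten_mapP; exists n; rewrite ?mem_index_iota ?leqnn// inE pL orbT.
    exists (index p (flat n)) => //=.
    have up : u (index p (flat n)) = p.
      by apply: etrans (nth_index _ pf); apply/esym/uE; rewrite index_mem.
    by rewrite up.
  move=> k; have /andP[_ /le_trans] := diam_ball (u k).1 (u0 k); apply.
  by rewrite lee_fin; have := ule k; lra.
apply: lime_le.
  apply: is_cvg_nneseries => n _ _; rewrite lee_fin /diam_pow.
  by case: ifPn => // _; exact: powR_ge0.
apply: nearW => K; rewrite sumEFin lee_fin.
apply: (@le_trans _ _ (2 `^ s * \sum_(0 <= k < K) (u k).2 `^ s)).
  rewrite mulr_sumr; apply: ler_sum => k _.
  by rewrite -powRM//; exact: diam_pow_ball.
rewrite mulrC -ler_pdivlMr//; have := usum K.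
by rewrite le_min => /andP[].
Qed.

Lemma hausdorff_dim_hnull S : (forall s, 0 < s -> hnull s S) -> hausdorff_dim S = 0%E.
Proof.
move=> H; apply/eqP; rewrite eq_le; apply/andP; split; last first.
  by apply: le_ereal_inf_tmp => _ [s /= [s0 _] <-]; rewrite lee_fin.
apply/lee_addgt0Pr => e e0; rewrite add0e.
apply: ge_ereal_inf; exists e%:E => //; exists e => //; split; first exact: ltW.
by apply: hausdorff_measure_hnull => //; exact: H.
Qed.

End HausdorffNull.

(** * Words made of copies of their prefixes *)

Section Codes.
Variable l : nat.
Hypothesis l0 : (0 < l)%N.

(* [copy_word n B i e] appends to the [n]-digit binary word [B] a copy of its
   first [i] digits, shifted by the carry [e - 1], with [e < 3]. *)
Definition copy_word (n B i e : nat) : nat :=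
  2 ^ i * B + (B %/ 2 ^ (n - i) + 2 ^ i + e - 1) %% 2 ^ i.

(* [coded n B r]: the [n]-digit word [B] is spelled out by [r] free digits and by
   copies, of length at least [l], of prefixes of what has been written so far. *)
Inductive coded : nat -> nat -> nat -> Prop :=
| coded_nil : coded 0 0 0
| coded_free n B r d : coded n B r -> (d < 2)%N -> coded n.+1 (2 * B + d) r.+1
| coded_copy n B r i e : coded n B r -> (l <= i)%N -> (i <= n)%N -> (e < 3)%N ->
    coded (n + i) (copy_word n B i e) r.

(* [f] is the recursion fuel; [f >= n] is enough. *)
Fixpoint codes (f n : nat) : seq (nat * nat) :=
  match n, f with
  | 0, _ => [:: (0%N, 0%N)]
  | _, 0 => [::]
  | n'.+1, f'.+1 =>
    [seq ((2 * p.1 + d)%N, p.2.+1) | p <- codes f' n', d <- iota 0 2] ++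
    flatten [seq [seq (copy_word (n'.+1 - i) p.1 i e, p.2) | p <- codes f' (n'.+1 - i), e <- iota 0 3]
            | i <- index_iota l n'.+2]
  end.

Lemma codesS f n : codes f.+1 n.+1 =
  [seq ((2 * p.1 + d)%N, p.2.+1) | p <- codes f n, d <- iota 0 2] ++
  flatten [seq [seq (copy_word (n.+1 - i) p.1 i e, p.2) | p <- codes f (n.+1 - i), e <- iota 0 3]
          | i <- index_iota l n.+2].
Proof. by []. Qed.

Lemma coded_codes n B r : coded n B r -> forall f, (n <= f)%N -> (B, r) \in codes f n.
Proof.
elim => {n B r} [f _|n B r d _ IH d2 f nf|n B r i e _ IH li iN e3 f nf].
- by case: f => [|f]; rewrite inE.
- case: f nf => // f nf; rewrite codesS mem_cat; apply/orP; left.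
  by apply/allpairsP; exists ((B, r), d); split; [exact: IH|rewrite mem_iota|].
have i0 : (0 < i)%N by exact: leq_trans li.
case: f nf => [|f nf]; first by lia.
have [m mE] : exists m, (n + i = m.+1)%N by exists (n + i).-1; lia.
rewrite mE codesS mem_cat; apply/orP; right; apply/flatten_mapP; exists i.
  by rewrite mem_index_iota li/=; lia.
have -> : (m.+1 - i = n)%N by lia.
apply/allpairsP; exists ((B, r), e); split; [apply: IH; lia|by rewrite mem_iota|by []].
Qed.

(** Induction on the last block. A free digit has two values of weight 1 / 4, a copy of length i has
    three carries and gains X^-i; each kind accounts for at most half of the bound. *)
Lemma codes_weight (R : realType) (X : R) f n : 1 <= X ->
  (forall m, 3 * \sum_(l <= i < m) X ^- i <= 2^-1) -> \sum_(p <- codes f n) 4 ^- p.2 <= X ^+ n.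
Proof.
move=> X1 Xl; have X0 : 0 < X := lt_le_trans ltr01 X1.
elim: f n => [|f IH] [|n].
- by rewrite /= big_seq1 !expr0 invr1.
- by rewrite /= big_nil exprn_ge0// ltW.
- by rewrite /= big_seq1 !expr0 invr1.
rewrite codesS; set s1 := (X in X ++ _); set s2 := (X in _ ++ X).
rewrite big_cat/= {}/s1 {}/s2 big_flatten big_map [X in _ + X]big_flatten big_map.
have Y0 (p : nat * nat) : 0 <= (4 ^- p.2 : R) by rewrite invr_ge0 exprn_ge0.
apply: (@le_trans _ _ (2^-1 * X ^+ n + 2^-1 * X ^+ n.+1)); last first.
  have half (x y : R) : x <= y -> 2^-1 * x + 2^-1 * y <= y by lra.
  by apply: half; rewrite ler_weXn2l.
apply: lerD.
  apply: le_trans (ler_wpM2l _ (IH n)); rewrite ?invr_ge0 ?ler0n//.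
  rewrite mulr_sumr; apply: ler_sum => p _.
  have quarter (x : R) : 0 <= x -> 4^-1 * x + (4^-1 * x + 0) <= 2^-1 * x by lra.
  by rewrite !big_cons big_nil/= exprS invfM; apply: quarter.
apply: le_trans (ler_wpM2r (exprn_ge0 n.+1 (ltW X0)) (Xl n.+2)).
rewrite mulr_sumr mulr_suml big_nat [leRHS]big_nat; apply: ler_sum => i /andP[_ iN].
apply: (@le_trans _ _ (3 * X ^+ (n.+1 - i))).
  apply: le_trans (ler_wpM2l _ (IH _)); rewrite ?ler0n//.
  rewrite big_flatten big_map mulr_sumr; apply: ler_sum => p _.
  have three (x : R) : 0 <= x -> x + (x + (x + 0)) <= 3 * x by lra.
  by rewrite !big_cons big_nil/=; apply: three.
rewrite -mulrA ler_wpM2l// le_eqVlt; apply/orP; left; apply/eqP.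
by rewrite -[in RHS](subnK (n := n.+1) (m := i))// exprD mulrC mulfK// expf_neq0// gt_eqF.
Qed.

End Codes.

(** * Binary prefixes and close returns *)

Section Digits.
Variable R : realType.
Implicit Types b x : R.

(** For b in [0, 1), the whole prefix of k binary digits, read as an integer. *)
Definition dig b k : nat := Num.trunc (2 ^+ k * b).

Lemma dig_itv b k : 0 <= b -> (dig b k)%:R <= 2 ^+ k * b < (dig b k).+1%:R.
Proof. by move=> b0; apply: truncn_itv; rewrite mulr_ge0// exprn_ge0. Qed.

Lemma dig0 b : 0 <= b < 1 -> dig b 0 = 0%N.
Proof.
move=> /andP[b0 b1]; have /andP[h _] := dig_itv 0 b0.
apply/eqP; rewrite -leqn0 -ltnS -(ltr_nat R); apply: le_lt_trans h _.
by rewrite expr0 mul1r.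
Qed.

Lemma dig_div b k i : 0 <= b -> dig b k = (dig b (k + i) %/ 2 ^ i)%N.
Proof.
move=> b0; have /andP[h1 h2] := dig_itv k b0; have /andP[g1 g2] := dig_itv (k + i) b0.
have e0 : 0 < 2 ^+ i :> R by rewrite exprn_gt0.
apply/eqP; rewrite eqn_leq; apply/andP; split.
  rewrite leq_divRL ?expn_gt0// -ltnS -(ltr_nat R) natrM natrX.
  apply: le_lt_trans g2; rewrite exprD; nra.
rewrite -ltnS ltn_divLR ?expn_gt0// -(ltr_nat R) natrM natrX.
apply: le_lt_trans g1 _; rewrite exprD; nra.
Qed.

Lemma digS b k : 0 <= b -> exists2 d, (d < 2)%N & dig b k.+1 = (2 * dig b k + d)%N.
Proof.
move=> b0; exists (dig b k.+1 %% 2)%N; first by rewrite ltn_mod.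
by rewrite (dig_div k 1 b0) addn1 expn1 mulnC -divn_eq.
Qed.

(** After multiplication by 2^i the error in 2^k b = b + z is at most 1, so the integer parts of
    2^(k + i) b and 2^i b differ modulo 2^i by a carry -1, 0 or 1. *)
Lemma dig_copy b k i : 0 <= b -> (0 < i <= k)%N -> ret b k <= 2 ^- i ->
  exists2 e, (e < 3)%N & dig b (k + i) = copy_word k (dig b k) i e.
Proof.
move=> b0 /andP[i0 ik] rk.
have [z hz] := snorm_near (2 ^+ k * b - b); have {}hz := le_trans hz rk.
have e2 : 2 <= 2 ^+ i :> R by exact: exp2_ge2.
have bk : 0 <= 2 ^+ k * b - b.
  by rewrite subr_ge0 ler_peMl// exprn_ege1// ler1n.
have z0 : (0 <= z).
  rewrite -ltzD1 -(ltr_int R) intrD; move: hz; rewrite ler_norml => /andP[_].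
  have : 2 ^- i <= 2^-1 :> R by rewrite lef_pV2 ?posrE ?exprn_gt0.
  lra.
case: z hz z0 => // z; rewrite -pmulrn => hz _.
set K := dig b k; set Y := dig b i; set X := dig b (k + i).
have /andP[Y1 Y2] := dig_itv i b0; have /andP[X1 X2] := dig_itv (k + i) b0.
rewrite -/Y -/X in X1 X2 Y1 Y2.
have hd : `|2 ^+ (k + i) * b - 2 ^+ i * b - 2 ^+ i * z%:R| <= 1.
  rewrite (_ : _ - _ = 2 ^+ i * (2 ^+ k * b - b - z%:R)); last by rewrite exprD; ring.
  by rewrite normrM gtr0_norm ?exprn_gt0// mulrC -ler_pdivlMr ?exprn_gt0// div1r.
move: hd; rewrite ler_norml => /andP[d1 d2].
rewrite -natr1 in X2; rewrite -natr1 in Y2.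
have a1 : (Y + 2 ^ i * z < X + 2)%N by rewrite -(ltr_nat R) !natrD natrM natrX; lra.
have a2 : (X < Y + 2 ^ i * z + 2)%N by rewrite -(ltr_nat R) !natrD natrM natrX; lra.
exists (X + 1 - (Y + 2 ^ i * z))%N; first by lia.
rewrite /copy_word -/K.
have -> : (K %/ 2 ^ (k - i) = Y)%N by rewrite /Y (dig_div i (k - i) b0) subnKC.
have -> : ((Y + 2 ^ i + (X + 1 - (Y + 2 ^ i * z)) - 1) %% 2 ^ i = X %% 2 ^ i)%N.
  rewrite -[RHS](modnMDl 1) -[LHS](modnMDl z) mul1n; congr (_ %% _)%N.
  have : (0 < 2 ^ i)%N by rewrite expn_gt0.
  by move: a1 a2; rewrite [(z * _)%N]mulnC; move: (2 ^ i * z)%N (2 ^ i)%N => u v; lia.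
by rewrite /K (dig_div k i b0) -/X mulnC -divn_eq.
Qed.

End Digits.

(** * Parsing the digits of b *)

Section Parsing.
Variable R : realType.
Implicit Types b : R.

Lemma ret_shift b k t : snorm (2 ^+ t * (2 ^+ k * b) - b) = ret b (k + t).
Proof. by rewrite /ret mulrA -exprD addnC. Qed.

(** Slow returns force (C + 2) i <= C k, so a largest i exists and the prefix to be copied is
    already written. Maximality bounds the cost of the return. *)
Lemma longest_match b C k : slow_returns b C -> (0 < k)%N ->
  exists i, [/\ (i <= k)%N, ret b k <= 2 ^- ((C + 2) * i) &
                - ln (ret b k) <= ((C + 2) * i.+1)%:R].
Proof.
move=> HC k0; pose P i := ret b k <= 2 ^- ((C + 2) * i).
have P0 : exists i, P i by exists 0%N; rewrite /P muln0 expr0 invr1 ret_le1.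
have Pk i : P i -> (i <= k)%N.
  move=> /(le_trans (HC k k0)); rewrite lef_pV2 ?posrE ?exprn_gt0// ler_eXn2l ?ltr1n//.
  by nia.
case: (ex_maxnP P0 Pk) => i Pi imax; exists i; split => //; first exact: Pk.
have h : 2 ^- ((C + 2) * i.+1) < ret b k.
  by rewrite ltNge; apply/negP => /imax; rewrite ltnn.
rewrite lerNl; apply: le_trans (_ : ln (2 ^- ((C + 2) * i.+1)) <= _); last first.
  by rewrite ler_ln ?posrE ?(slow_ret_gt0 HC)// ?ltW// invr_gt0 exprn_gt0.
by rewrite ln_exp2V lerN2 -[leRHS]mulr1 ler_wpM2l// ln2_le1.
Qed.

(** The return at time k is paid directly. The next n returns shadow the first n ones, at an extra
    cost of at most 1 each. *)
Lemma match_cost b C i k n (M : nat) : slow_returns b C -> (0 < k)%N ->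
  ret b k <= 2 ^- ((C + 2) * i) -> - ln (ret b k) <= ((C + 2) * i.+1)%:R ->
  (n < i)%N -> - logsum b n <= M%:R * n%:R ->
  \sum_(k <= j < k + n.+1) - ln (ret b j) <= ((C + 2) * i.+1 + M * n + n)%:R.
Proof.
move=> HC k0 hi cost ni HM; rewrite addnS big_ltn ?ltnS ?leq_addr//.
rewrite !natrD -addrA; apply: lerD cost _.
have := @shadow_sum _ b C (2 ^+ k * b) i n HC hi (ltnW ni).
have -> : \sum_(1 <= t < n.+1) - ln (snorm (2 ^+ t * (2 ^+ k * b) - b)) =
    \sum_(k.+1 <= j < (k + n).+1) - ln (ret b j).
  rewrite -{1}[k.+1]add1n big_addn -addnS addnC addnK.
  by apply: eq_bigr => t _; rewrite ret_shift addnC.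
by move/le_trans; apply; rewrite natrM lerD2r.
Qed.

(* A copied block of length [i] costs at most [(M + O(C)) i], a free digit only
   [(C + 2) l]; the copy that overruns [N] accounts for the last term. *)
Lemma coded_returns b C l (M N : nat) : 0 <= b -> slow_returns b C -> (0 < l)%N ->
  (forall j, (j < N)%N -> - logsum b j <= M%:R * j%:R) ->
  forall k r, (0 < k <= N.+1)%N -> coded l k (dig b k) r ->
  exists n' r', [/\ (N < n')%N, coded l n' (dig b n') r', (r <= r')%N &
    \sum_(k <= j < N.+1) - ln (ret b j) +
      ((M + 2 * C + 5)%:R - ((C + 2) * l)%:R) * (r'%:R - r%:R) <=
    (M + 2 * C + 5)%:R * (N.+1%:R - k%:R) + (2 * (C + 2) * N)%:R].
Proof.
move=> b0 HC l0 HM k r; move: {2}(N.+1 - k)%N (leqnn (N.+1 - k)) => m.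
elim: m k r => [|m IH] k r km /andP[k0 kN] ck.
  have -> : k = N.+1 by lia.
  exists N.+1, r; split => //; first by have <- : k = N.+1 by lia.
  by rewrite big_geq// !subrr !mulr0 !add0r.
have [kE|kN1] := eqVneq k N.+1.
  by apply: IH; rewrite ?k0 ?kN// kE subnn.
have {}kN : (k <= N)%N by rewrite -ltnS ltn_neqAle kN1.
have [i [ik hi cost]] := longest_match HC k0.
(* A match shorter than l is ignored: one free digit is written, and the return costs at most (C +
   2) l. *)
have [il|li] := ltnP i l.
  have [d d2 dE] := digS k b0.
  have km' : (N.+1 - k.+1 <= m)%N by lia.
  have ck' : coded l k.+1 (dig b k.+1) r.+1 by rewrite dE; exact: coded_free.
  have [n' [r' [Nn cn' rr' hs]]] := IH k.+1 r.+1 km' kN ck'.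
  exists n', r'; split => //; first exact: ltnW.
  rewrite big_ltn ?ltnS//.
  have cl : - ln (ret b k) <= ((C + 2) * l)%:R.
    by rewrite (le_trans cost)// ler_nat leq_mul2l il orbT.
  by rewrite -(natr1 r) -(natr1 k) in hs; lra.
have i0 : (0 < i)%N by exact: leq_trans li.
have [e e3 dE] : exists2 e, (e < 3)%N & dig b (k + i) = copy_word k (dig b k) i e.
  apply: dig_copy; rewrite ?i0 ?ik//; apply: le_trans hi _.
  by rewrite lef_pV2 ?posrE ?exprn_gt0// ler_eXn2l ?ltr1n//; nia.
have ci : coded l (k + i) (dig b (k + i)) r by rewrite dE; exact: coded_copy.
have [kiN|Nki] := leqP (k + i) N.+1.
  have km' : (N.+1 - (k + i) <= m)%N by lia.
  have kiN' : (0 < k + i <= N.+1)%N by rewrite kiN addn_gt0 k0.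
  have [n' [r' [Nn cn' rr' hs]]] := IH (k + i)%N r km' kiN' ci.
  exists n', r'; split => //.
  rewrite (big_cat_nat (n := k + i))//= ?leq_addr//.
  have jN : (i.-1 < N)%N by lia.
  have ii : (i.-1 < i)%N by lia.
  have := match_cost HC k0 hi cost ii (HM _ jN).
  rewrite prednK// => cst.
  have : ((C + 2) * i.+1 + M * i.-1 + i.-1 <= (M + 2 * C + 5) * i)%N by nia.
  rewrite -(ler_nat R) (natrM R (_ + 5)) => cst2.
  by rewrite (natrD R k i) in hs; lra.
(* The copy runs past N: parsing stops, and only N - k steps of shadowing are charged. *)
exists (k + i)%N, r; split => //; first exact: ltnW.
rewrite subrr mulr0 addr0.
have jN : (N - k < N)%N by lia.
have ii : (N - k < i)%N by lia.
have := match_cost HC k0 hi cost ii (HM _ jN).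
have -> : (k + (N - k).+1 = N.+1)%N by lia.
move=> /le_trans; apply; rewrite -natrB; last exact: leqW.
by rewrite -natrM -natrD ler_nat; nia.
Qed.

End Parsing.

(** * Covers of the slow case *)

Section DimensionZero.
Variable R : realType.
Implicit Types b s : R.

Lemma geometric_tail (q : R) m N : 0 <= q < 1 ->
  \sum_(m <= n < N) q ^+ n <= q ^+ m / (1 - q).
Proof.
move=> /andP[q0 q1]; have q1' : 0 < 1 - q by rewrite subr_gt0.
rewrite ler_pdivlMr//; have [Nm|/ltnW mN] := leqP N m.
  by rewrite big_geq// mul0r exprn_ge0.
suff -> : (\sum_(m <= n < N) q ^+ n) * (1 - q) = q ^+ m - q ^+ N.
  by rewrite lerBlDr lerDl exprn_ge0.
move/subnKC: mN => <-; elim: (N - m)%N => [|j IH]; first by rewrite addn0 big_geq// mul0r subrr.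
by rewrite addnS big_nat_recr ?leq_addr//= mulrDl IH exprS; ring.
Qed.

Lemma exp_small (q e : R) : 0 <= q < 1 -> 0 < e -> exists n, q ^+ n <= e.
Proof.
move=> /andP[q0 q1] e0.
have := @cvg_expr _ q; rewrite ger0_norm// => /(_ q1)/cvgrPdist_le/(_ e e0)[n _ /(_ n (leqnn n))].
by rewrite /= sub0r normrN ger0_norm ?exprn_ge0//; exists n.
Qed.

Lemma powR_exp2V s n : (2 ^- n) `^ s = (2^-1 `^ s) ^+ n :> R.
Proof.
elim: n => [|n IH]; first by rewrite !expr0 invr1 powR1.
by rewrite exprS invfM powRM ?invr_ge0 ?exprn_ge0// IH exprS.
Qed.

Lemma half_powR_itv s : 0 < s -> 0 < (2^-1 : R) `^ s < 1.
Proof.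
move=> s0; rewrite powR_gt0 ?invr_gt0//=.
rewrite [ltRHS](_ : 1 = 1 `^ s); last by rewrite powR1.
apply: gt0_ltr_powR => //; rewrite ?nnegrE//; lra.
Qed.

(** This crude bound forces a time n with sum below -M n to be large when M is. *)
Lemma logsum_slow_ge b C n : slow_returns b C -> - logsum b n <= (C * n * n)%:R.
Proof.
move=> HC; rewrite /logsum -sumrN.
apply: (@le_trans _ _ (\sum_(1 <= k < n.+1) (C * n)%:R)).
  rewrite big_nat [leRHS]big_nat; apply: ler_sum => k /andP[k0 kn].
  have h : ln (2 ^- (C * k) : R) <= ln (ret b k).
    by rewrite ler_ln ?posrE ?(slow_ret_gt0 HC)// ?HC// invr_gt0 exprn_gt0.
  rewrite lerNl (le_trans _ h)// ln_exp2V lerN2 -[leRHS]mulr1.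
  by apply: ler_pM => //; rewrite ?ln2_le1 ?ln_ge0 ?ler1n// ler_nat leq_mul2l -ltnS kn orbT.
by rewrite sumr_const_nat subn1 -[leLHS]mulr_natr -natrM.
Qed.

Lemma hnull_slow s C : 0 < s -> hnull s [set b | [/\ 0 <= b < 1, slow_returns b C &
  forall M : nat, exists n, (0 < n)%N /\ M%:R * n%:R <= - logsum b n]].
Proof.
move=> s0 e e0; have /andP[u0 u1] := half_powR_itv s0; set u := _ `^ s in u0 u1.
(* X > 1 is such that X^2 2^-s < 1. One factor X bounds the weighted count of words of
   [codes_weight]; the other compensates the weight 4^-r. *)
pose X := 1 + (1 - u) / 4.
have X1 : 1 < X by rewrite /X; lra.
have X0 : 0 < X by lra.
pose rho := X * X * u.
have rho01 : 0 <= rho < 1.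
  apply/andP; split; first by rewrite /rho !mulr_ge0// ltW.
  rewrite /rho /X; nra.
have Xi01 : 0 <= X^-1 < 1 by rewrite invr_ge0 ltW//= invf_lt1.
have [l [l0 Xl]] : exists l, (0 < l)%N /\ forall m, 3 * \sum_(l <= i < m) X ^- i <= 2^-1.
  have Xi : 0 < 1 - X^-1 by rewrite subr_gt0; case/andP: Xi01.
  have [l hl] := exp_small Xi01 (ltac:(by apply: divr_gt0 Xi _) : 0 < (1 - X^-1) / 6).
  exists l.+1; split => // m.
  have -> : \sum_(l.+1 <= i < m) X ^- i = \sum_(l.+1 <= i < m) X^-1 ^+ i.
    by apply: eq_bigr => i _; rewrite exprVn.
  have h := @geometric_tail X^-1 l.+1 m Xi01.
  have : X^-1 ^+ l.+1 / (1 - X^-1) <= 6^-1.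
    rewrite ler_pdivrMr// mulrC; apply: le_trans hl.
    by rewrite exprS ler_piMl// ?exprn_ge0 ?invr_ge0 ?(ltW X0)// ltW//; case/andP: Xi01.
  lra.
have [h Xh] : exists h, 4 <= X ^+ h.
  have [h hh] := exp_small Xi01 (ltac:(by []) : 0 < (4^-1 : R)).
  by exists h; rewrite exprVn lef_pV2 ?posrE ?exprn_gt0 in hh.
have rho1 : 0 < 1 - rho by rewrite subr_gt0; case/andP: rho01.
have [n0 hn0] := exp_small rho01 (ltac:(by rewrite divr_gt0// mulr_gt0) : 0 < e * (1 - rho) / 4).
(* At most n / h + 1 free digits, so that 4^r <= 4 X^n. *)
pose good n (p : nat * nat) := (h * p.2 <= n + h)%N.
pose L n : seq (R * R) := if (n < n0)%N then [::] else
  [seq (p.1%:R / 2 ^+ n, 2 ^- n) | p <- codes l n n & good n p].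
exists L; split => [b /= [/andP[b0 b1] HC HM]|n p|N].
(* In [coded_returns] the total cost M N cancels the main term and leaves (4 C + 9) N, so the first
   two summands yield h (r' - 1) <= N. The last two force N >= n0. *)
- pose M := (h * (4 * C + 9) + (C + 2) * l + C * n0 + 1)%N.
  have hML : (h * (4 * C + 9) + (C + 2) * l <= M + 2 * C + 5)%N.
    by rewrite /M -!addnA leq_add2l leq_addr.
  have hMC : (C * n0 < M)%N by rewrite /M addn1 ltnS leq_addl.
  clearbody M.
  have exN : exists n, (0 < n)%N && (M%:R * n%:R <= - logsum b n).
    by have [n [n1 n2]] := HM M; exists n; rewrite n1.
  case: (ex_minnP exN) => N /andP[N0 hN] Nmin {exN}.
  have HMj j : (j < N)%N -> - logsum b j <= M%:R * j%:R.
    move=> jN; have [->|j0] := posnP j; first by rewrite logsum0 oppr0 mulr0.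
    rewrite leNgt; apply/negP => /ltW hj.
    by have := Nmin j; rewrite j0 hj leqNgt jN => /(_ isT).
  (* Returns start at time 1, so the first digit is written freely. *)
  have c1 : coded l 1 (dig b 1) 1.
    have [d d2 ->] := digS 0 b0; rewrite dig0 ?b0//.
    exact: coded_free (coded_nil l) d2.
  have [n' [r' [Nn cn' rr' hs]]] := coded_returns b0 HC l0 HMj (ltac:(by []) : (0 < 1 <= N.+1)%N) c1.
  rewrite sumrN -/(logsum b N) in hs.
  have n0N : (n0 <= N)%N.
    have := le_trans hN (logsum_slow_ge N HC); rewrite -natrM ler_nat leq_pmul2r//.
    move=> hh; have : (C * n0 < C * N)%N.
      exact: leq_trans hMC hh.
    by rewrite ltn_mul2l => /andP[_ /ltnW].
  exists n', ((dig b n')%:R / 2 ^+ n', 2 ^- n'); split; last first.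
    have e0' : 0 < 2 ^+ n' :> R by rewrite exprn_gt0.
    have -> : b - (dig b n')%:R / 2 ^+ n' = (2 ^+ n' * b - (dig b n')%:R) / 2 ^+ n'.
      by field; rewrite gt_eqF.
    rewrite normrM [X in _ * X]gtr0_norm ?invr_gt0//.
    rewrite -[leRHS]mul1r ler_wpM2r ?invr_ge0 ?(ltW e0')//.
    by have := dig_itv n' b0; rewrite -natr1 ler_norml; lra.
  rewrite /L ltnNge (leq_trans n0N (ltnW Nn))/=; apply/mapP; exists (dig b n', r') => //.
  rewrite mem_filter (coded_codes l0 cn')// andbT /good/=.
  have hr : (h * (4 * C + 9) * (r' - 1) <= (4 * C + 9) * N)%N.
    have hM : (h * (4 * C + 9))%:R <= (M + 2 * C + 5)%:R - ((C + 2) * l)%:R :> R.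
      rewrite lerBrDr -[leLHS]natrD ler_nat; exact: hML.
    have r0 : 0 <= r'%:R - 1%:R :> R by rewrite subr_ge0 ler_nat.
    have {}hM := ler_wpM2r r0 hM.
    rewrite -(ler_nat R) (natrM R (h * (4 * C + 9))) (natrB R rr').
    apply: le_trans hM _.
    have E1 : N.+1%:R - 1%:R = N%:R :> R by rewrite -natr1 addrK.
    have E2 : (M + 2 * C + 5)%:R = M%:R + (2 * C + 5)%:R :> R by rewrite -natrD addnA.
    have E3 : ((4 * C + 9) * N)%:R = (2 * C + 5)%:R * N%:R + (2 * (C + 2) * N)%:R :> R.
      by rewrite -natrM -natrD; congr (_%:R); clear; lia.
    move: hs; rewrite E1 E3; set Q := (_ - _) * _; rewrite E2 mulrDl => hs.
    by move: hs hN; clear; lra.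
  have : (h * (r' - 1) <= N)%N.
    by move: hr; rewrite [(h * _)%N]mulnC -mulnA leq_pmul2l// addnS.
  by rewrite mulnBr muln1; move: (h * r')%N Nn; clear; lia.
- rewrite /L; case: ifP => // _ /mapP[q _ ->] /=.
  by rewrite invr_ge0 exprn_ge0.
have Ln n : \sum_(p <- L n) p.2 `^ s <= if (n < n0)%N then 0 else 4 * rho ^+ n.
  rewrite /L; case: ifP => _; first by rewrite big_nil.
  rewrite big_map big_filter /= powR_exp2V -/u.
  apply: (@le_trans _ _ (\sum_(p <- codes l n n) (4 * X ^+ n * u ^+ n) * 4 ^- p.2)).
    rewrite big_mkcond/=; apply: ler_sum => p _.
    have un : 0 <= u ^+ n by rewrite exprn_ge0// ltW.
    case: ifP => [|_]; last first.
      by rewrite !mulr_ge0 ?invr_ge0 ?exprn_ge0// ltW.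
    rewrite /good => gp.
    rewrite ler_pdivlMr ?exprn_gt0// mulrC; apply: ler_wpM2r => //.
    case: p.2 gp => [_|r hr].
      by rewrite expr0; have := exprn_ege1 n (ltW X1); lra.
    rewrite exprS ler_wpM2l//.
    apply: (@le_trans _ _ ((X ^+ h) ^+ r)).
      by apply: lerXn2r; rewrite ?nnegrE ?exprn_ge0// ltW.
    by rewrite -exprM ler_weXn2l// ?ltW//; move: hr; clear; lia.
  rewrite -mulr_sumr; apply: le_trans (ler_wpM2l _ (codes_weight n n (ltW X1) Xl)) _.
    by rewrite !mulr_ge0 ?exprn_ge0// ltW.
  by rewrite /rho !exprMn le_eqVlt; apply/orP; left; apply/eqP; ring.
apply: (@le_trans _ _ (\sum_(n0 <= n < N) 4 * rho ^+ n)).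
  apply: le_trans (ler_sum _ (fun n _ => Ln n)) _.
  have [Nn|/ltnW nN] := leqP N n0.
    rewrite big_nat big1 ?[leRHS]big_geq// => n /andP[_ nN].
    by rewrite (leq_trans nN).
  rewrite (big_cat_nat (n := n0))//= big_nat big1 ?add0r.
    rewrite big_nat [leRHS]big_nat; apply: ler_sum => n /andP[nn _].
    by rewrite ltnNge nn.
  by move=> n /andP[_ ->].
rewrite -mulr_sumr; apply: le_trans (ler_wpM2l _ (geometric_tail n0 N rho01)) _ => //.
by rewrite mulrA ler_pdivrMr// mulrC -ler_pdivlMr.
Qed.

End DimensionZero.

(** * Covers of the fast case, and statement (6) *)

Section DimensionZeroAlpha.
Variable R : realType.
Implicit Types b s : R.

(** A return below 2^-(C k) puts b within that distance of some j / (2^k - 1). Level k thus needs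
    2^(k + 1) intervals, and the levels form a geometric series of ratio 2 u^C. *)
Lemma hnull_fast s : 0 < s ->
  hnull s [set b : R | 0 <= b < 1 /\ ~ exists C, slow_returns b C].
Proof.
move=> s0 e e0; have /andP[u0 u1] := half_powR_itv s0; set u := _ `^ s in u0 u1.
have u01 : 0 <= u < 1 by rewrite ltW.
(* The first bound makes the ratio at most 1 / 2; the total is then at most 8 u^C. *)
have [C uC] : exists C, u ^+ C <= Num.min 4^-1 (e / 8).
  by apply: exp_small => //; rewrite lt_min invr_gt0 ltr0n divr_gt0.
move: uC; rewrite le_min => /andP[uC1 uC2].
pose L k : seq (R * R) := if k is 0 then [::] else
  [seq (j%:R / (2 ^+ k - 1), 2 ^- (C * k)) | j <- iota 0 (2 ^ k.+1)].
exists L; split => [b /= [/andP[b0 b1] nslow]|n p|N].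
- have [k [k0 rk]] : exists k, (0 < k)%N /\ ret b k < 2 ^- (C * k).
    apply: contrapT => nk; apply: nslow; exists C => k k0.
    by rewrite leNgt; apply/negP => h; apply: nk; exists k.
  have [z hz] := snorm_near (2 ^+ k * b - b); have {}hz := le_lt_trans hz rk.
  have e2 := @exp2B1_gt0 R k k0 : 0 < 2 ^+ k - 1 :> R.
  have e2' := @exp2_ge2 R k k0 : 2 <= 2 ^+ k :> R.
  have c1 : 2 ^- (C * k) <= 1 :> R by rewrite invf_le1 ?exprn_gt0// exprn_ege1// ler1n.
  have bk : 0 <= 2 ^+ k * b - b by rewrite subr_ge0 ler_peMl//; lra.
  have := lt_le_trans hz c1; rewrite ltr_norml => /andP[z1 z2].
  have z0 : 0 <= z by rewrite -ltzD1 -(ltr_int R) intrD; lra.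
  case: z hz z1 z2 z0 => // j; rewrite -pmulrn => hz z1 z2 _.
  exists k, (j%:R / (2 ^+ k - 1), 2 ^- (C * k)); split.
    case: k k0 rk hz e2 e2' c1 bk z1 z2 => // k _ rk hz e2 e2' c1 bk z1 z2.
    apply/mapP; exists j => //; rewrite mem_iota/= add0n -(ltr_nat R) natrX exprS.
    have : (2 ^+ k.+1 - 1) * b <= 2 ^+ k.+1 - 1 by rewrite ler_piMr// ltW.
    by move: (2 ^+ k.+1 : R) e2' z1 => w; clear; lra.
  rewrite /= (_ : b - _ = (2 ^+ k * b - b - j%:R) / (2 ^+ k - 1)); last by field; rewrite gt_eqF.
  rewrite normrM [X in _ * X]gtr0_norm ?invr_gt0//.
  by rewrite ler_pdivrMr// (le_trans (ltW hz))// ler_peMr ?invr_ge0 ?exprn_ge0//; lra.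
- by case: n => [//|n] /mapP[j _ ->] /=; rewrite invr_ge0 exprn_ge0.
pose d := 2 * u ^+ C.
have Lk k : \sum_(p <- L k.+1) p.2 `^ s <= 2 * d ^+ k.+1.
  rewrite /L big_map /= powR_exp2V -/u.
  have -> : iota 0 (2 ^ k.+2) = index_iota 0 (2 ^ k.+2) by rewrite /index_iota subn0.
  rewrite sumr_const_nat subn0 -[leLHS]mulr_natr natrX exprM /d exprMn (exprS 2 k.+1).
  by rewrite le_eqVlt; apply/orP; left; apply/eqP; ring.
have d0 : 0 <= d by rewrite /d mulr_ge0// exprn_ge0// ltW.
have d1 : d <= 2^-1 by rewrite /d; lra.
case: N => [|N]; first by rewrite big_geq// ltW.
rewrite big_nat_recl// {1}/L big_nil add0r.
apply: (@le_trans _ _ (2 * d * \sum_(0 <= k < N) d ^+ k)).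
  rewrite mulr_sumr; apply: ler_sum => k _; apply: le_trans (Lk k) _.
  by rewrite exprS mulrA.
have d01 : 0 <= d < 1 by rewrite d0/=; lra.
apply: le_trans (ler_wpM2l _ (geometric_tail 0 N d01)) _; first by rewrite mulr_ge0.
rewrite expr0 div1r; have : (1 - d)^-1 <= 2.
  by rewrite invf_ple ?posrE//; lra.
move/(ler_wpM2l (mulr_ge0 (ler0n R 2) d0))/le_trans; apply.
by rewrite /d; lra.
Qed.

Lemma ret_addn b j k : ret (b + j%:R) k = ret b k.
Proof.
rewrite /ret (_ : _ - _ = 2 ^+ k * b - b + ((2 ^+ k - 1) * Posz j)%:~R) ?snormDz//.
by rewrite intrM intrB rmorphXn/= -pmulrn; ring.
Qed.

Lemma logsum_addn b j n : logsum (b + j%:R) n = logsum b n.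
Proof. by apply: eq_bigr => k _; rewrite ret_addn. Qed.

Lemma hausdorff_dim_alpha :
  hausdorff_dim [set c : R | (c \in `[0, 1[) /\ (alpha c = -oo%E)] = 0%E.
Proof.
apply: hausdorff_dim_hnull => s s0.
(* Index 0 holds the fast case, index C + 1 the slow case of rate C. *)
pose S i : set R := if i is C.+1 then [set b | [/\ 0 <= b < 1, slow_returns b C &
    forall M : nat, exists n, (0 < n)%N /\ M%:R * n%:R <= - logsum b n]]
  else [set b | 0 <= b < 1 /\ ~ exists C, slow_returns b C].
have HS : hnull s (\bigcup_i S i).
  by apply: hnull_bigcup => -[|C]; [exact: hnull_fast|exact: hnull_slow].
have := @hnull_bigcup _ s (fun j => [set c | (\bigcup_i S i) (2^-1 + j%:R - c)]).
move=> /(_ (fun j => hnull_reflect (2^-1 + j%:R) HS)); apply: hnullS.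
move=> c [c01 /alpha_mstar/mstar_eqNy HM].
set b := 2^-1 - c in HM.
(* As b lies in (-1/2, 1/2], j is 0 or 1; the returns are invariant under this translation. *)
have [j bj] : exists j : nat, 0 <= b + j%:R < 1.
  move: c01; rewrite in_itv/= => /andP[c0 c1].
  have [b0|b0] := leP 0 b.
    by exists 0%N; rewrite addr0 b0/= ltrBlDr ltr_wpDr// invf_lt1 ?ltr1n.
  exists 1%N; rewrite -[1%:R]/1; apply/andP; split; last by rewrite -ltrBrDr subrr.
  by rewrite /b; lra.
exists j => //=; rewrite (_ : 2^-1 + j%:R - c = b + j%:R); last by rewrite /b; ring.
have [[C HC]|nC] := pselect (exists C, slow_returns (b + j%:R) C); last by exists 0%N.
exists C.+1 => //; split => // M; have [n [n0 hn]] := HM M%:R; exists n; split => //.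
rewrite retsumE in hn; last first.
  by move=> k /andP[k0 _]; rewrite -(ret_addn b j) gt_eqF// (slow_ret_gt0 HC).
by rewrite logsum_addn; rewrite lte_fin ltrNr in hn; exact: ltW.
Qed.

End DimensionZeroAlpha.

(** * The product formula for the sine *)

Section RootsOfUnity.
Import complex complex.ComplexField.Normc.
Variable R : realType.
Implicit Types a b y : R.

Definition cis a : complex R := Complex (cos (2 * pi * a)) (sin (2 * pi * a)).

Lemma cisD a b : cis (a + b) = cis a * cis b.
Proof.
apply/eqP; rewrite /cis mulrDr cosD sinD eq_complex /=; apply/andP; split; apply/eqP; ring.
Qed.

Lemma cis0 : cis 0 = 1.
Proof. by rewrite /cis mulr0 cos0 sin0. Qed.

Lemma cisMn a n : cis (n%:R * a) = cis a ^+ n.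
Proof.
elim: n => [|n IH]; first by rewrite mul0r cis0 expr0.
by rewrite -natr1 mulrDl mul1r cisD IH exprSr.
Qed.

Lemma cis_nat n : cis n%:R = 1.
Proof.
rewrite -[n%:R]mulr1 cisMn [cis 1](_ : _ = 1) ?expr1n//.
by rewrite /cis mulr1 mulr_natl cos2pi sin2pi.
Qed.

Lemma normc_cisB a b : normc (cis a - cis b) = 2 * snorm (a - b).
Proof.
rewrite /normc /cis /=.
set s := (a + b); set d := (a - b).
have -> : 2 * pi * a = pi * s + pi * d by rewrite /s /d; ring.
have -> : 2 * pi * b = pi * s - pi * d by rewrite /s /d; ring.
rewrite cosD cosB sinD sinB.
set x := cos (pi * s); set y := sin (pi * s); set u := cos (pi * d); set v := sin (pi * d).
have xy : x ^+ 2 + y ^+ 2 = 1 by exact: cos2Dsin2.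
have -> : (x * u - y * v - (x * u + y * v)) ^+ 2 + (y * u + x * v - (y * u - x * v)) ^+ 2
  = (2 * v) ^+ 2.
  by rewrite -[RHS]mulr1 -[X in _ = _ * X]xy; ring.
by rewrite sqrtr_sqr normrM ger0_norm.
Qed.

Lemma cis_eq1 a : cis a = 1 -> exists z : int, a = z%:~R.
Proof.
move=> h; have := normc_cisB a 0; rewrite cis0 h subrr normc0 subr0 => /esym/eqP.
by rewrite mulf_eq0 pnatr_eq0/= => /eqP/snorm_eq0.
Qed.

Lemma normc_prod (I : Type) (r : seq I) (F : I -> complex R) :
  normc (\prod_(i <- r) F i) = \prod_(i <- r) normc (F i).
Proof. by apply: (big_morph _ (@normcM R)); exact: normc1. Qed.

Lemma prod_periodic (S : comRingType) (G : nat -> S) m k :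
  (forall j, G (j + m)%N = G j) ->
  \prod_(0 <= j < k * m) G j = (\prod_(0 <= j < m) G j) ^+ k.
Proof.
move=> Gm; elim: k => [|k IH]; first by rewrite big_geq.
rewrite mulSn (big_cat_nat (n := m))// ?leq_addr//= exprS; congr (_ * _).
by rewrite -{1}[m]add0n big_addn addKn -IH; apply: eq_bigr => j _.
Qed.

(* Products of [2 |sin|] over the multiples of [p / q]: only the order [m] of
   [e^(2 i pi p / q)] matters, and [m] is at least [q / p]. *)
Lemma snorm_prod q p : (0 < q)%N -> exists m,
  [/\ (0 < m)%N, (m %| q)%N, (q %| p * m)%N & forall y,
  \prod_(0 <= j < q) (2 * snorm (y + p%:R * j%:R / q%:R)) =
  (2 * snorm (m%:R * y)) ^+ (q %/ m)].
Proof.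
move=> q0; have q0' : q%:R != 0 :> R by rewrite pnatr_eq0 -lt0n.
pose w := cis (p%:R / q%:R).
have wq : w ^+ q = 1 by rewrite -cisMn mulrC divfK// cis_nat.
have [m pw mq] := prim_order_exists q0 wq.
have m0 : (0 < m)%N := prim_order_gt0 pw.
have wm : w ^+ m = 1 := prim_expr_order pw.
exists m; split => //.
  have [z] : exists z : int, m%:R * (p%:R / q%:R) = z%:~R :> R.
    by apply: cis_eq1; rewrite cisMn.
  rewrite mulrA => /(congr1 (fun x => x * q%:R)); rewrite divfK//.
  rewrite -!natrM !pmulrn -intrM => /eqP; rewrite eqr_int => /eqP e.
  have : (q %| (m * p)%N%:Z)%Z by rewrite e dvdz_mull.
  by rewrite mulnC.
move=> y; have Ej j : 2 * snorm (y + p%:R * j%:R / q%:R) = normc (cis (- y) - w ^+ j).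
  rewrite -cisMn normc_cisB -[snorm (y + _)]snormN; congr (_ * snorm _); ring.
under eq_bigr do rewrite Ej.
(* The q factors are q / m copies of one period, whose product is X^m - 1 evaluated at e^(-2 i pi
   y). *)
rewrite -normc_prod -{1}(divnK mq) prod_periodic; last by move=> j; rewrite exprD wm mulr1.
have := factor_Xn_sub_1 pw => /(congr1 (fun P => P.[cis (- y)])).
rewrite horner_prod hornerD hornerXn hornerN hornerC.
under eq_bigr do rewrite hornerD hornerX hornerN hornerC.
move=> ->; rewrite -cisMn -cis0.
elim: (q %/ m)%N => [|k IH]; first by rewrite !expr0 normc1.
by rewrite !exprS normcM IH normc_cisB subr0 mulrN snormN.
Qed.

End RootsOfUnity.

(** * Integrals of periodic functions *)

Section AffineIntegral.
Variable R : realType.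
Local Notation leb := (@lebesgue_measure R).
Implicit Types (a t x y L : R).

Lemma measurable_affine a t : measurable_fun [set: R] (fun x => a * x + t).
Proof.
by apply: measurable_funD => //; exact: mulrl_measurable.
Qed.

Lemma preimage_affine_itv a t u v (b1 b2 : bool) : 0 < a ->
  (fun x => a * x + t) @^-1` [set` Interval (BSide b1 u) (BSide b2 v)] =
  [set` Interval (BSide b1 ((u - t) / a)) (BSide b2 ((v - t) / a))].
Proof.
move=> a0; apply/seteqP; split => x /=; rewrite !in_itv/= => /andP[h1 h2]; apply/andP; split.
- by case: b1 h1 => /= h; rewrite ?ler_pdivrMr ?ltr_pdivrMr//; lra.
- by case: b2 h2 => /= h; rewrite ?ler_pdivlMr ?ltr_pdivlMr//; lra.
- by case: b1 h1 => /=; rewrite ?ler_pdivrMr ?ltr_pdivrMr//; lra.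
- by case: b2 h2 => /=; rewrite ?ler_pdivlMr ?ltr_pdivlMr//; lra.
Qed.

(** The right-hand side is a measure in A that agrees with Lebesgue measure on half-open intervals,
    which determine it. *)
Lemma lebesgue_affine a t (a0 : 0 < a) A : measurable A ->
  leb A = (a%:E * leb ((fun x => (a * x + t)%R) @^-1` A))%E.
Proof.
pose phi : measurableTypeR R -> measurableTypeR R := fun x => a * x + t.
have mphi : measurable_fun setT phi by exact: measurable_affine.
pose nu : {measure set (measurableTypeR R) -> \bar R} :=
  measure_function_pushforward__canonical__measure_function_Measure leb mphi.
pose k := NngNum (ltW a0).
have H := @lebesgue_measure_unique R (mscale k nu).
move=> mA; rewrite H// => X [[u v]] _ <-.
rewrite -[RHS]/(a%:E * leb (phi @^-1` `]u, v]%classic))%E.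
rewrite [phi @^-1` _](preimage_affine_itv t u v false false a0).
rewrite !lebesgue_measure_itv/= !lte_fin.
rewrite ltr_pM2r ?invr_gt0// ltrD2r; case: ifP => _; last by rewrite mule0.
by rewrite -!EFinB -EFinM; congr EFin; field; rewrite gt_eqF.
Qed.

Lemma ge0_integral_affine a t (D : set R) (h : R -> \bar R) : 0 < a ->
  measurable D -> measurable_fun setT h -> (forall y, (0 <= h y)%E) ->
  (\int[leb]_(y in D) h y =
   a%:E * \int[leb]_(x in (fun x => (a * x + t)%R) @^-1` D) h (a * x + t)%R)%E.
Proof.
move=> a0 mD mh h0.
pose phi : measurableTypeR R -> measurableTypeR R := fun x => a * x + t.
have mphi : measurable_fun setT phi by exact: measurable_affine.
pose k := NngNum (ltW a0).
have H := @ge0_integral_pushforward _ _ _ _ R phi mphi leb D h mD (measurable_funTS mh) (fun y _ => h0 y).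
rewrite -[X in (_ * X)%E]H.
pose nu : {measure set (measurableTypeR R) -> \bar R} :=
  measure_function_pushforward__canonical__measure_function_Measure leb mphi.
have H2 := @ge0_integral_mscale _ _ R nu D mD k h (measurable_funTS mh) (fun y _ => h0 y).
rewrite -[RHS]H2.
by apply: eq_measure_integral => A mA _; exact: lebesgue_affine.
Qed.

Lemma integral_translate t (D : set R) (f : R -> \bar R) :
  measurable D -> measurable_fun setT f ->
  (\int[leb]_(y in D) f y = \int[leb]_(x in (fun x => (x + t)%R) @^-1` D) f (x + t)%R)%E.
Proof.
move=> mD mf; rewrite integralE [RHS]integralE.
rewrite (ge0_integral_affine t ltr01 mD (measurable_funepos mf)); last by move=> y; exact: funepos_ge0.
rewrite (ge0_integral_affine t ltr01 mD (measurable_funeneg mf)); last by move=> y; exact: funeneg_ge0.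
have E : (fun x : R => 1 * x + t) = (fun x => x + t) by apply/funext => x; rewrite mul1r.
rewrite !mul1e !E; congr (_ - _)%E; apply: eq_integral => x _; rewrite mul1r; [by rewrite !funeposE|by rewrite !funenegE].
Qed.

End AffineIntegral.

Section PeriodicIntegral.
Variable R : realType.
Local Notation leb := (@lebesgue_measure R).
Implicit Types (a t x y L K : R) (f h : R -> \bar R).

Lemma preimage_translate t L : (fun x => x + t) @^-1` `[t, t + L[%classic = `[0, L[%classic.
Proof.
by apply/seteqP; split => x /=; rewrite !in_itv/= => /andP[h1 h2]; apply/andP; split; lra.
Qed.

Lemma itv_split_addn L n : 0 <= L ->
  `[0, n.+1%:R * L[%classic = `[0, n%:R * L[%classic `|` `[n%:R * L, n%:R * L + L[%classic :> set R.
Proof.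
move=> L0; have nL : 0 <= n%:R * L by rewrite mulr_ge0.
rewrite -natr1 mulrDl mul1r; apply/seteqP; split => x /=; rewrite !in_itv/=.
  by move=> /andP[h1 h2]; have [h|h] := ltP x (n%:R * L); [left|right]; apply/andP.
by move=> [/andP[h1 h2]|/andP[h1 h2]]; apply/andP; split => //; lra.
Qed.

Lemma integral_fold n L f : 0 <= L -> measurable_fun setT f ->
  (\int[leb]_(x in `[0%R, (n%:R * L)%R[) f x =
   \sum_(0 <= j < n) \int[leb]_(x in `[0%R, L[) f (x + j%:R * L)%R)%E.
Proof.
move=> L0 mf; elim: n => [|n IH].
  by rewrite big_geq// mul0r set_itvco0 integral_set0.
rewrite itv_split_addn// integral_setU//; first last.
- apply/disj_setPS => x /=; rewrite !in_itv/= => -[/andP[_ h1] /andP[h2 _]].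
  by have := lt_le_trans h1 h2; rewrite ltxx.
- exact: measurable_funTS.
rewrite IH big_nat_recr//=; congr (_ + _)%E.
by rewrite (@integral_translate R (n%:R * L))// preimage_translate.
Qed.

Lemma integral_periodic_nat n h K : measurable_fun setT h -> (forall y, (0 <= h y)%E) ->
  (forall y, h (y + 1) = h y) -> (\int[leb]_(x in `[0%R, 1%R[) h x <= K%:E)%E ->
  (\int[leb]_(x in `[0%R, n%:R[) h x <= (n%:R * K)%:E)%E.
Proof.
move=> mh h0 hper hK.
have hn x j : h (x + j%:R) = h x.
  by elim: j => [|j IHj]; rewrite ?addr0// -natr1 addrA hper.
have := @integral_fold n 1 h ler01 mh; rewrite mulr1 => ->.
elim: n => [|n IH]; first by rewrite big_geq// mul0r.
rewrite big_nat_recr//= -natr1 mulrDl mul1r EFinD leeD//.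
by under eq_integral do rewrite mulr1 hn.
Qed.

(** An interval of length n starting at t lies in n + 1 unit cells with integer endpoints. *)
Lemma integral_periodic_itv t n h K : measurable_fun setT h -> (forall y, (0 <= h y)%E) ->
  (forall y, h (y + 1) = h y) -> (\int[leb]_(x in `[0%R, 1%R[) h x <= K%:E)%E ->
  (\int[leb]_(x in `[t, (t + n%:R)%R[) h x <= (n.+1%:R * K)%:E)%E.
Proof.
move=> mh h0 hper hK.
pose z : R := (Num.floor t)%:~R.
have hz x : h (x + z) = h x.
  have hn y j : h (y + j%:R) = h y.
    by elim: j => [|j IHj]; rewrite ?addr0// -natr1 addrA hper.
  rewrite /z; case: (Num.floor t) => j; first by rewrite -pmulrn hn.
  by rewrite NegzE mulrNz -[RHS](hn _ j.+1) -[in RHS](subrK j.+1%:R x) !hn.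
have sub : `[t, t + n%:R[ `<=` `[z, z + n.+1%:R[.
  have := floor_itv t; rewrite -/z intrD -/z => /andP[z1 z2].
  move=> x /=; rewrite !in_itv/= -natr1 => /andP[x1 x2]; apply/andP; split; lra.
apply: (@le_trans _ _ (\int[leb]_(x in `[z, (z + n.+1%:R)%R[) h x)%E).
  by apply: ge0_subset_integral => //; exact: measurable_funTS.
rewrite (@integral_translate R z)// preimage_translate.
under eq_integral do rewrite hz.
exact: integral_periodic_nat.
Qed.

(** The image interval has length n + 1 and meets at most n + 2 unit cells; the factor 2 comes from
    n + 2 <= 2 (n + 1). *)
Lemma integral_periodic_affine a t L n h K : 0 < a -> a * L = n.+1%:R ->
  measurable_fun setT h -> (forall y, (0 <= h y)%E) ->
  (forall y, h (y + 1) = h y) -> 0 <= K -> (\int[leb]_(x in `[0%R, 1%R[) h x <= K%:E)%E ->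
  (\int[leb]_(x in `[0%R, L[) h (a * x + t)%R <= (2 * L * K)%:E)%E.
Proof.
move=> a0 aL mh h0 hper K0 hK.
have := @integral_periodic_itv t n.+1 _ _ mh h0 hper hK.
rewrite (ge0_integral_affine t a0)//.
rewrite (preimage_affine_itv t t (t + n.+1%:R) true true a0).
have -> : (t - t) / a = 0 by rewrite subrr mul0r.
have -> : (t + n.+1%:R - t) / a = L.
  by rewrite -aL addrAC subrr add0r mulrC mulrA mulVf ?mul1r// gt_eqF.
rewrite -lee_pdivlMl// -EFinM => /le_trans; apply; rewrite lee_fin.
rewrite (_ : 2 * L * K = a^-1 * ((2 * (a * L)) * K)); last by field; rewrite gt_eqF.
rewrite ler_wpM2l ?invr_ge0 ?(ltW a0)// ler_wpM2r// aL -natrM ler_nat.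
by rewrite mul2n -addnn -addn1 leq_add.
Qed.

End PeriodicIntegral.

(** * Decay of correlations of ln |2 sin| *)

Section LogSineSquare.
Variable R : realType.
Local Notation leb := (@lebesgue_measure R).
Implicit Types (x y : R).

(* At the integers [logsine] is [ln 0 = 0]. *)
Definition logsine y : R := ln (2 * snorm y).

Lemma measurable_logsine : measurable_fun [set: R] logsine.
Proof.
apply: (@measurableT_comp _ _ _ _ _ _ (@ln R)); first exact: measurable_ln.
by apply: measurable_funM => //; exact: measurable_snorm.
Qed.

Lemma logsineD1 y : logsine (y + 1) = logsine y.
Proof. by rewrite /logsine snormD1. Qed.

(** As 2 k + 1 = (k + 1)^2 - k^2, a point within 2^-n of 0 or 1 collects at least (n + 1)^2. This
    dominates the square of [logsine] when n is the largest exponent with [snorm y] at most 2^-n. *)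
Let layer (k : nat) y : \bar R :=
  ((2 * k + 1)%:R%:E * ((\1_(`[0%R, 2 ^- k]%classic : set R) y)%:E +
     (\1_(`[(1 - 2 ^- k)%R, 1%R]%classic : set R) y)%:E))%E.

Let layer_ge0 k y : (0 <= layer k y)%E.
Proof. by rewrite mule_ge0 ?lee_fin// adde_ge0// lee_fin. Qed.

Lemma logsine_sq_layer y : 0 <= y < 1 ->
  ((logsine y ^+ 2)%:E <= \sum_(0 <= k <oo) layer k y)%E.
Proof.
move=> /andP[y0 y1].
have lim_ge n : (\sum_(0 <= k < n) layer k y <= \sum_(0 <= k <oo) layer k y)%E.
  by apply: nneseries_lim_ge => k _ _; exact: layer_ge0.
have [s0|s0] := eqVneq (snorm y) 0.
  rewrite /logsine s0 mulr0 ln0// expr0n/=.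
  by apply: nneseries_ge0 => k _ _; exact: layer_ge0.
have {}s0 : 0 < snorm y by rewrite lt_neqAle eq_sym s0 snorm_ge0.
pose P n := snorm y <= 2 ^- n.
have P0 : exists n, P n by exists 0%N; rewrite /P expr0 invr1 snorm_le1.
have Pub n : P n -> (n <= Num.trunc (snorm y)^-1)%N.
  rewrite /P => h; rewrite -ltnS -(ltr_nat R).
  apply: le_lt_trans (truncnS_gt _).
  rewrite (@le_trans _ _ (2 ^+ n))//; last by rewrite -[leLHS]invrK lef_pV2 ?posrE// invr_gt0 exprn_gt0.
  by rewrite -natrX ler_nat ltnW// ltn_expl.
case: (ex_maxnP P0 Pub) => n hn nmax.
have hn1 : 2 ^- n.+1 < snorm y by rewrite ltNge; apply/negP => /nmax; rewrite ltnn.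
apply: le_trans (lim_ge n.+1).
have layer_one k : (k <= n)%N -> ((2 * k + 1)%:R%:E <= layer k y)%E.
  move=> kn; have sk : snorm y <= 2 ^- k.
    by apply: le_trans hn _; rewrite lef_pV2 ?posrE ?exprn_gt0// ler_eXn2l ?ltr1n.
  rewrite /layer -[leLHS]mule1 lee_pmul2l// !indicE -EFinD lee_fin.
  have [yh|yh] := leP y 2^-1.
    have yk : y <= 2 ^- k.
      by apply: le_trans sk; have := @snorm_ge R y; rewrite ger0_norm//; apply.
    by rewrite mem_set ?lerDl//= in_itv/= y0.
  have yk : 1 - y <= 2 ^- k.
    apply: le_trans sk; rewrite -(snormBz y 1).
    have := @snorm_ge R (y - 1); rewrite ler0_norm ?subr_le0 ?(ltW y1)// opprB; apply; lra.
  by rewrite [X in _ + (nat_of_bool X)%:R]mem_set ?lerDr//= in_itv/= (ltW y1) andbT; lra.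
apply: (@le_trans _ _ (\sum_(0 <= k < n.+1) (2 * k + 1)%:R%:E)%E); last first.
  by rewrite big_nat [leRHS]big_nat; apply: lee_sum => k /andP[_ kn]; exact: layer_one.
rewrite sumEFin lee_fin.
have -> : \sum_(0 <= k < n.+1) (2 * k + 1)%:R = n.+1%:R ^+ 2 :> R.
  elim: n.+1 => [|m IH]; first by rewrite big_geq// expr0n.
  by rewrite big_nat_recr//= IH -!natrX -natrD; congr (_%:R); lia.
have s2 : 0 < 2 * snorm y by rewrite mulr_gt0.
have l1 : logsine y <= n.+1%:R.
  apply: (@le_trans _ _ (ln 2)).
    by rewrite /logsine ler_ln ?posrE// ler_piMr// snorm_le1.
  by apply: le_trans (@ln2_le1 R) _; rewrite ler1n.
have l2 : - n.+1%:R <= logsine y.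
  apply: (@le_trans _ _ (ln (2 ^- n))).
    rewrite ln_exp2V lerN2; apply: (@le_trans _ _ (n%:R * 1)).
      by rewrite ler_wpM2l// ln2_le1.
    by rewrite mulr1 ler_nat.
  rewrite /logsine ler_ln ?posrE ?invr_gt0 ?exprn_gt0//.
  by move: hn1; rewrite exprS invfM => /ltW; rewrite ler_pdivrMl.
by rewrite -subr_ge0 subr_sqr mulr_ge0 ?subr_ge0// addrC -lerBlDr sub0r.
Qed.

Lemma integral_layer k : (\int[leb]_y layer k y = ((2 * k + 1)%:R * (2 * 2 ^- k))%:E)%E.
Proof.
have e0 : 0 < 2 ^- k :> R by rewrite invr_gt0 exprn_gt0.
have mI (A : set R) : measurable A -> measurable_fun setT (fun y => (\1_A y)%:E : \bar R).
  by move=> mA; apply/measurable_EFinP; exact: measurable_indic.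
rewrite /layer ge0_integralZl//; first last.
- by move=> y _; rewrite adde_ge0// lee_fin.
- by apply: emeasurable_funD; exact: mI.
rewrite ge0_integralD//; [|exact: mI|exact: mI].
rewrite !integral_indic// !setIT.
transitivity ((2 * k + 1)%:R%:E * (leb `[0%R, 2 ^- k]%classic +
  leb `[(1 - 2 ^- k)%R, 1%R]%classic))%E; first by [].
rewrite !lebesgue_measure_itv/= !lte_fin e0.
rewrite ltrBlDr ltrDl e0 -!EFinB -EFinD -EFinM; congr EFin; lra.
Qed.

(** 12 is the sum over all k of the layer integrals 2 (2 k + 1) 2^-k. *)
Lemma integral_logsine_sq : (\int[leb]_(y in `[0%R, 1%R[) (logsine y ^+ 2)%:E <= 12%:E)%E.
Proof.
have mI (A : set R) : measurable A -> measurable_fun setT (fun y => (\1_A y)%:E : \bar R).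
  by move=> mA; apply/measurable_EFinP; exact: measurable_indic.
have mlayer k : measurable_fun setT (layer k).
  by apply: measurable_funeM; apply: emeasurable_funD; exact: mI.
have mseries : measurable_fun setT (fun y => \sum_(0 <= k <oo) layer k y)%E.
  apply: ge0_emeasurable_sum; first by move=> k y _ _; exact: layer_ge0.
  by move=> k _; exact: mlayer.
apply: (@le_trans _ _ (\int[leb]_(y in `[0%R, 1%R[) \sum_(0 <= k <oo) layer k y)%E).
  apply: ge0_le_integral => //.
  - by move=> y _; rewrite lee_fin sqr_ge0.
  - apply: measurable_funTS; apply/measurable_EFinP.
    exact: measurable_funX measurable_logsine.
  - by apply: measurable_funTS; exact: mseries.
  - by move=> y; rewrite /= in_itv/= => yy; exact: logsine_sq_layer.
apply: (@le_trans _ _ (\int[leb]_y \sum_(0 <= k <oo) layer k y)%E).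
  apply: ge0_subset_integral => //.
  by move=> y _; apply: nneseries_ge0 => k _ _; exact: layer_ge0.
rewrite integral_nneseries//.
apply: lime_le; first by apply: is_cvg_nneseries => k _ _; exact: integral_ge0.
apply: nearW => N; under eq_bigr do rewrite integral_layer.
rewrite sumEFin lee_fin.
suff -> : \sum_(0 <= k < N) (2 * k + 1)%:R * (2 * 2 ^- k) = 12 - (8 * N + 12)%:R * 2 ^- N :> R.
  by rewrite lerBlDr lerDl mulr_ge0// invr_ge0 exprn_ge0.
elim: N => [|N IH]; first by rewrite big_geq// expr0 invr1 mulr1 muln0 add0n subrr.
rewrite big_nat_recr//= IH exprS invfM !natrD !natrM -natr1.
by field; rewrite expf_neq0.
Qed.

End LogSineSquare.

(** * Correlations between frequencies *)

Section Correlation.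
Variable R : realType.
Local Notation leb := (@lebesgue_measure R).
Implicit Types (x y t s : R) (p q m n : nat).

Definition wave p t x : R := logsine (p%:R * x + t).

Lemma measurable_wave p t : measurable_fun [set: R] (wave p t).
Proof. exact: measurableT_comp (@measurable_logsine R) (measurable_affine _ _). Qed.

Lemma wave_shift p t s x : wave p t (x + s) = wave p (t + p%:R * s) x.
Proof. by rewrite /wave; congr logsine; ring. Qed.

Lemma wave_shiftV q t j x : (0 < q)%N -> wave q t (x + j%:R / q%:R) = wave q t x.
Proof.
move=> q0; rewrite wave_shift /wave [q%:R * (_ / _)]mulrC divfK ?pnatr_eq0 -?lt0n//.
by rewrite addrA /logsine snormDn.
Qed.

(** The logarithm of [snorm_prod], away from the zeros of the product, where ln 0 = 0 does not
    respect products. *)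
Lemma logsine_sum q p : (0 < q)%N -> exists m, [/\ (0 < m)%N, (m %| q)%N, (q %| p * m)%N &
  forall y, snorm (m%:R * y) != 0 ->
  \sum_(0 <= j < q) logsine (y + p%:R * j%:R / q%:R) = (q %/ m)%:R * logsine (m%:R * y)].
Proof.
move=> q0; have [m [m0 mq qpm H]] := @snorm_prod R q p q0; exists m; split => // y s0.
have spos : 0 < 2 * snorm (m%:R * y).
  by rewrite mulr_gt0// lt_neqAle eq_sym s0 snorm_ge0.
have Ppos : \prod_(0 <= j < q) (2 * snorm (y + p%:R * j%:R / q%:R)) != 0.
  by rewrite H expf_neq0// gt_eqF.
have fpos j : (j < q)%N -> 0 < 2 * snorm (y + p%:R * j%:R / q%:R).
  move=> jq; rewrite lt_neqAle mulr_ge0 ?snorm_ge0// andbT eq_sym.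
  apply: contraNneq Ppos => h; apply/eqP.
  by rewrite (bigD1_seq j) ?iota_uniq ?mem_index_iota//= h mul0r.
have lnprod n : (n <= q)%N ->
    ln (\prod_(0 <= j < n) (2 * snorm (y + p%:R * j%:R / q%:R))) =
    \sum_(0 <= j < n) logsine (y + p%:R * j%:R / q%:R) /\
    0 < \prod_(0 <= j < n) (2 * snorm (y + p%:R * j%:R / q%:R)).
  elim: n => [|n IH] nq; first by rewrite !big_geq// ln1.
  have [I1 I2] := IH (ltnW nq).
  rewrite !big_nat_recr//= lnM ?posrE ?fpos// I1; split => //.
  by rewrite mulr_gt0// fpos.
have [<- _] := lnprod q (leqnn q).
by rewrite H lnXn// -[LHS]mulr_natl.
Qed.

Lemma negligible_integer_points (a t : R) : a != 0 -> exists N : set R,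
  [/\ measurable N, leb N = 0%E & [set x | snorm (a * x + t) = 0] `<=` N].
Proof.
move=> a0; pose N : set R := range (fun z : int => (z%:~R - t) / a).
have cN : countable N by exact: card_le_trans (card_image_le _ _) (countableP _).
exists N; split.
- exact: countable_measurable.
- exact: countable_lebesgue_measure0.
move=> x /= /snorm_eq0[z hz]; by exists z => //; rewrite -hz addrK mulrAC mulfV ?mul1r.
Qed.

Lemma wave_sq_le p t (L : R) n : (0 < p)%N -> p%:R * L = n.+1%:R ->
  (\int[leb]_(x in `[0%R, L[) (wave p t x ^+ 2)%:E <= (24 * L)%:E)%E.
Proof.
move=> p0 pL; have p0' : 0 < p%:R :> R by rewrite ltr0n.
pose h y : \bar R := (logsine y ^+ 2)%:E.
have mh : measurable_fun setT h.
  by apply/measurable_EFinP; exact: measurable_funX (@measurable_logsine R).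
have h0 y : (0 <= h y)%E by rewrite lee_fin sqr_ge0.
have hper y : h (y + 1) = h y by rewrite /h logsineD1.
have := @integral_periodic_affine R p%:R t L n h 12 p0' pL mh h0 hper (ler0n _ _) (@integral_logsine_sq R).
by rewrite (_ : 2 * L * 12 = 24 * L)//; ring.
Qed.

Lemma wave_sq_le1 p t : (0 < p)%N ->
  (\int[leb]_(x in `[0%R, 1%R[) (wave p t x ^+ 2)%:E <= 24%:E)%E.
Proof.
case: p => // p _; have := @wave_sq_le p.+1 t 1 p isT; rewrite !mulr1; exact.
Qed.

Lemma measurable_wave_sq p t : measurable_fun [set: R] (fun x => (wave p t x ^+ 2)%:E : \bar R).
Proof. by apply/measurable_EFinP; exact: measurable_funX (measurable_wave p t). Qed.

Lemma integrable_wave_sq p t : (0 < p)%N ->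
  leb.-integrable `[0%R, 1%R[ (fun x => (wave p t x ^+ 2)%:E).
Proof.
move=> p0; apply/integrableP; split.
  by apply: measurable_funTS; exact: measurable_wave_sq.
under eq_integral do rewrite gee0_abs ?lee_fin ?sqr_ge0//.
exact: le_lt_trans (wave_sq_le1 t p0) (ltry _).
Qed.

Lemma ler_norm_mul_sq (a b : R) : `|a * b| <= 2^-1 * (a ^+ 2 + b ^+ 2).
Proof.
rewrite normrM; have := sqr_ge0 (`|a| - `|b|).
by rewrite -[a ^+ 2]real_normK ?num_real// -[b ^+ 2]real_normK ?num_real// sqrrB; lra.
Qed.

Lemma integrable_waveM p q t s : (0 < p)%N -> (0 < q)%N ->
  leb.-integrable `[0%R, 1%R[ (fun x => (wave p t x * wave q s x)%:E).
Proof.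
move=> p0 q0.
apply: le_integrable (integrableD _ (integrable_wave_sq t p0) (integrable_wave_sq s q0)) => //.
  apply: measurable_funTS; apply/measurable_EFinP.
  exact: measurable_funM (measurable_wave p t) (measurable_wave q s).
move=> x _ /=; rewrite lee_fin [leRHS]ger0_norm ?addr_ge0 ?sqr_ge0//.
apply: le_trans (ler_norm_mul_sq _ _) _.
by have := sqr_ge0 (wave p t x); have := sqr_ge0 (wave q s x); lra.
Qed.

(* Translating by [j / q] fixes the wave of frequency [q] and turns the other
   one, summed over [j], into a single wave of amplitude [q / m]. *)
Lemma wave_correlation p q t s : (0 < p)%N -> (0 < q)%N ->
  (`|\int[leb]_(x in `[0%R, 1%R[) (wave p t x * wave q s x)%:E| <= (24 * p%:R / q%:R)%:E)%E.
Proof.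
move=> p0 q0; have q0' : 0 < q%:R :> R by rewrite ltr0n.
have qi0 : 0 <= q%:R^-1 :> R by rewrite invr_ge0 ltW.
have mW u v : measurable_fun [set: R] (fun x => (wave p u x * wave q v x)%:E : \bar R).
  by apply/measurable_EFinP; exact: measurable_funM (measurable_wave _ _) (measurable_wave _ _).
have sub01 : `[0, q%:R^-1[%classic `<=` (`[0, 1[%classic : set R).
  move=> x /=; rewrite !in_itv/= => /andP[-> h] /=; apply: lt_le_trans h _.
  by rewrite invf_le1// ler1n.
(* [0, 1) is cut into q intervals of length 1 / q, on each of which the wave of frequency q repeats
   itself. *)
have := integral_fold q qi0 (mW t s); rewrite divff ?gt_eqF// => ->.
have E j : (\int[leb]_(x in `[0%R, (q%:R^-1)%R[)
     (wave p t (x + j%:R * q%:R^-1)%R * wave q s (x + j%:R * q%:R^-1)%R)%:E =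
   \int[leb]_(x in `[0%R, (q%:R^-1)%R[) (wave p (t + p%:R * (j%:R / q%:R)) x * wave q s x)%:E)%E.
  by apply: eq_integral => x _; rewrite wave_shiftV// wave_shift.
under eq_bigr do rewrite E.
rewrite -integral_sum//; last first.
  by move=> j; apply: integrableS (integrable_waveM _ _ p0 q0).
apply: (le_trans (le_abse_integral _ _ _)) => //.
  by apply: measurable_funTS; apply: emeasurable_sum => j; exact: mW.
have [m [m0 mq qpm sumE]] := @logsine_sum q p q0.
have pm0 : (0 < p * m)%N by rewrite muln_gt0 p0.
pose w x := wave (p * m) (m%:R * t) x.
have [N [mN N0 subN]] := @negligible_integer_points (p * m)%:R (m%:R * t)
  (ltac:(by rewrite pnatr_eq0 -lt0n) : (p * m)%:R != 0 :> R).
pose c : R := (q %/ m)%:R / 2.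
have c0 : 0 <= c by rewrite divr_ge0.
have mB : measurable_fun setT
    (fun x => c%:E * ((w x ^+ 2)%:E + (wave q s x ^+ 2)%:E) : \bar R)%E.
  by apply: measurable_funeM; apply: emeasurable_funD; exact: measurable_wave_sq.
apply: (@le_trans _ _ (\int[leb]_(x in `[0%R, (q%:R^-1)%R[)
    (c%:E * ((w x ^+ 2)%:E + (wave q s x ^+ 2)%:E)))%E).
  apply: ae_ge0_le_integral => //.
  - apply: measurableT_comp => //; apply: measurable_funTS.
    by apply: emeasurable_sum => j; exact: mW.
  - by move=> x _; rewrite mule_ge0// -EFinD lee_fin addr_ge0 ?sqr_ge0.
  - exact: measurable_funTS.
  exists N; split => // x /= /not_implyP[_ hx]; apply: subN => /=.
  apply: contrapT => /eqP nz; apply: hx.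
  have pmE : (p * m)%:R * x + m%:R * t = m%:R * (p%:R * x + t) by rewrite natrM; ring.
  rewrite sumEFin /= lee_fin -mulr_suml.
  have -> : \sum_(0 <= j < q) wave p (t + p%:R * (j%:R / q%:R)) x =
      (q %/ m)%:R * w x.
    rewrite /w /wave pmE -sumE -?pmE//; apply: eq_bigr => j _.
    by congr logsine; rewrite addrA mulrA.
  rewrite -mulrA normrM ger0_norm// /c -[leRHS]mulrA ler_wpM2l//.
  by apply: le_trans (ler_norm_mul_sq _ _) _.
rewrite ge0_integralZl//; first last.
- by move=> x _; rewrite -EFinD lee_fin addr_ge0 ?sqr_ge0.
- by apply: measurable_funTS; apply: emeasurable_funD; exact: measurable_wave_sq.
rewrite ge0_integralD//; first last.
- by apply: measurable_funTS; exact: measurable_wave_sq.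
- by move=> x _; rewrite lee_fin sqr_ge0.
- by apply: measurable_funTS; exact: measurable_wave_sq.
- by move=> x _; rewrite lee_fin sqr_ge0.
(* As q divides p m, both waves run through whole numbers of periods on [0, 1 / q). The squares then
   add up to 24 / m, and m >= q / p. *)
have [r rE] : exists r, (p * m = r.+1 * q)%N.
  by move/dvdnP: qpm => [[|r] hr]; [move: pm0; rewrite hr|exists r].
have h1 := @wave_sq_le (p * m) (m%:R * t) q%:R^-1 r pm0
  (ltac:(by rewrite rE natrM mulfK// gt_eqF) : (p * m)%:R * q%:R^-1 = r.+1%:R :> R).
have h2 := @wave_sq_le q s q%:R^-1 0 q0 (ltac:(by rewrite divff// gt_eqF) : q%:R * q%:R^-1 = 1%:R :> R).
have c0' : (0 <= c%:E)%E by rewrite lee_fin.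
apply: (le_trans (lee_wpmul2l c0' (leeD h1 h2))).
rewrite -EFinD -EFinM lee_fin /c.
have qm : (q %/ m)%:R = q%:R / m%:R :> R.
  by rewrite -{2}(divnK mq) natrM mulfK// pnatr_eq0 -lt0n.
rewrite qm.
have m0' : 0 < m%:R :> R by rewrite ltr0n.
have -> : q%:R / m%:R / 2 * (24 * q%:R^-1 + 24 * q%:R^-1) = 24 / m%:R :> R.
  by field; rewrite !gt_eqF.
rewrite -mulrA ler_wpM2l// ler_pdivlMr// mulrC ler_pdivrMr//.
by rewrite -natrM ler_nat (dvdn_leq pm0 qpm).
Qed.

End Correlation.

(** * Second moment of the sum over the frequencies 2^k - 1 *)

Section SecondMoment.
Variable R : realType.
Local Notation leb := (@lebesgue_measure R).
Implicit Types (x y t s c : R) (p q m n k l : nat).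

Definition freq k : nat := (2 ^ k - 1)%N.

Lemma freq_gt0 k : (0 < k)%N -> (0 < freq k)%N.
Proof. by move=> k0; rewrite subn_gt0 -[1%N](expn0 2) ltn_exp2l. Qed.

Lemma freqE k : (freq k)%:R = 2 ^+ k - 1 :> R.
Proof. by rewrite natrB ?expn_gt0// natrX. Qed.

(** The phase comes from b = 1/2 - c: the argument is -(2^k - 1) b, and [snorm] is even. *)
Definition rwave k c : R := wave (freq k) (- ((freq k)%:R / 2)) c.

Lemma rwaveE k c : rwave k c = ln (2 * ret (2^-1 - c) k).
Proof.
rewrite /rwave /wave /logsine /ret -[snorm (_ + _)]snormN freqE.
by congr (ln (2 * snorm _)); field.
Qed.

Lemma freq_ratio k l : (0 < k <= l)%N -> (freq k)%:R / (freq l)%:R <= 2 ^- (l - k) :> R.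
Proof.
move=> /andP[k0 kl]; have l0 := leq_trans k0 kl.
rewrite ler_pdivrMr ?ltr0n ?freq_gt0// mulrC ler_pdivlMr ?exprn_gt0//.
by rewrite !freqE mulrBl -exprD subnKC// mul1r lerD2l lerN2 exprn_ege1// ler1n.
Qed.

(** Subtraction on [nat] is truncated, so one of the two powers is 1 and the product is 2^-|k -
    l|. *)
Lemma rwave_correlation k l : (0 < k)%N -> (0 < l)%N ->
  (\int[leb]_(x in `[0%R, 1%R[) (rwave k x * rwave l x)%:E <=
    (24 * (2 ^- (l - k) * 2 ^- (k - l)))%:E)%E.
Proof.
wlog kl : k l / (k <= l)%N => [H k0 l0|k0 l0].
  have [kl|/ltnW lk] := leqP k l; first exact: H.
  rewrite [2 ^- _ * _]mulrC; under eq_integral do rewrite mulrC; exact: H.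
have -> : (k - l = 0)%N by apply/eqP; rewrite subn_eq0.
rewrite expr0 invr1 mulr1.
apply: (le_trans (lee_abs _)).
apply: (le_trans (wave_correlation _ _ (freq_gt0 k0) (freq_gt0 l0))).
by rewrite lee_fin -mulrA ler_wpM2l// freq_ratio// k0.
Qed.

Definition rsum n c : R := \sum_(1 <= k < n.+1) rwave k c.

Lemma measurable_rsum n : measurable_fun [set: R] (rsum n).
Proof. by apply: measurable_sum => k; exact: measurable_wave. Qed.

Lemma sum_decay k n : (k <= n)%N ->
  \sum_(0 <= l < n.+1) 2 ^- (l - k) * 2 ^- (k - l) <= 3 :> R.
Proof.
move=> kn; rewrite (big_cat_nat (n := k))//=; last by rewrite ltnW.
have h1 : \sum_(0 <= l < k) 2 ^- (l - k) * 2 ^- (k - l) = 1 - 2 ^- k :> R.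
  elim: k {kn} => [|k IH]; first by rewrite big_geq// expr0 invr1 subrr.
  rewrite big_nat_recl// (_ : (0 - k.+1 = 0)%N)// subn0 expr0 invr1 mul1r.
  under eq_bigr do rewrite !subSS.
  by rewrite IH exprS invfM; field; rewrite expf_neq0.
have h2 : \sum_(k <= l < n.+1) 2 ^- (l - k) * 2 ^- (k - l) = 2 - 2 ^- (n - k) :> R.
  rewrite -{1}[k]add0n big_addn subSn//.
  under eq_bigr => l _ do rewrite addnK subnDA subnAC subnn sub0n expr0 invr1 mulr1.
  elim: (n - k)%N => [|j IH]; first by rewrite big_nat1 expr0 invr1; lra.
  by rewrite big_nat_recr//= IH exprS invfM; field; rewrite expf_neq0.
have e1 : 0 <= 2 ^- k :> R by rewrite invr_ge0 exprn_ge0.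
have e2 : 0 <= 2 ^- (n - k) :> R by rewrite invr_ge0 exprn_ge0.
by rewrite h1 h2; lra.
Qed.

(** In the expanded square, each of the n rows of correlations sums to at most 24 * 3. *)
Lemma rsum_second_moment n :
  (\int[leb]_(x in `[0%R, 1%R[) (rsum n x ^+ 2)%:E <= (72 * n%:R)%:E)%E.
Proof.
have -> : (\int[leb]_(x in `[0%R, 1%R[) (rsum n x ^+ 2)%:E =
    \sum_(0 <= k < n) \sum_(0 <= l < n)
      \int[leb]_(x in `[0%R, 1%R[) (rwave k.+1 x * rwave l.+1 x)%:E)%E.
  have I k l : leb.-integrable `[0%R, 1%R[ (fun x => (rwave k.+1 x * rwave l.+1 x)%:E).
    by apply: integrable_waveM; exact: freq_gt0.
  under [RHS]eq_bigr => k _ do rewrite -(@integral_sum _ _ _ leb _ _ _ _ (I k))//.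
  rewrite -integral_sum//; last by move=> k; apply: integrable_sum => // l _; exact: I.
  apply: eq_integral => x _; under [RHS]eq_bigr do rewrite sumEFin.
  rewrite sumEFin; congr EFin.
  rewrite expr2 /rsum big_add1/= mulr_suml.
  by apply: eq_bigr => k _; rewrite mulr_sumr.
apply: (@le_trans _ _ (\sum_(0 <= k < n) 72%:E)%E); last first.
  by rewrite sumEFin sumr_const_nat subn0 lee_fin -[leLHS]mulr_natr.
rewrite big_nat [leRHS]big_nat; apply: lee_sum => k /andP[_ kn].
apply: (@le_trans _ _ (\sum_(0 <= l < n) (24 * (2 ^- (l - k) * 2 ^- (k - l)))%:E)%E).
  apply: lee_sum => l _.
  by have := @rwave_correlation k.+1 l.+1 isT isT; rewrite !subSS.
rewrite sumEFin lee_fin -mulr_sumr.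
case: n kn => // n kn; have := @sum_decay k n kn; lra.
Qed.

End SecondMoment.

(** * Almost everywhere convergence *)

Section AlmostEverywhere.
Variable R : realType.
Local Notation leb := (@lebesgue_measure R).
Implicit Types (x y t s c : R) (p q m n k l : nat).

(* Monotonicity fills the gaps between consecutive squares. *)
Lemma squares_squeeze (Q : nat -> R) (lam : R) : 0 <= lam ->
  {homo Q : m n / (m <= n)%N >-> m <= n} ->
  (forall e, 0 < e -> exists n0, forall n, (n0 <= n)%N ->
     `|Q (n ^ 2)%N - lam * n%:R ^+ 2| <= e * n%:R ^+ 2) ->
  forall e, 0 < e -> exists N0, forall N, (N0 <= N)%N -> `|Q N - lam * N%:R| <= e * N%:R.
Proof.
move=> lam0 Qm H e e0; pose d := e / 5; have d0 : 0 < d by rewrite divr_gt0.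
have [n0 Hn0] := H d d0.
(* Beyond this index the gap 2 n + 1 <= 3 n between consecutive squares, times lam, is at most d
   n^2. *)
pose n1 := maxn n0 (Num.trunc (3 * lam / d)).+1.
exists (n1 ^ 2)%N => N N1.
have exn : exists n, (n ^ 2 <= N)%N by exists 0%N.
have ubn n : (n ^ 2 <= N)%N -> (n <= N)%N.
  by apply: leq_trans; case: n => // n; rewrite expnS expn1 leq_pmulr.
case: (ex_maxnP exn ubn) => n nN nmax.
have Nn1 : (N < n.+1 ^ 2)%N by rewrite ltnNge; apply/negP => /nmax; rewrite ltnn.
have n1n : (n1 <= n)%N by exact: nmax.
have n0n : (n0 <= n)%N by apply: leq_trans n1n; rewrite leq_maxl.
have h1 := Hn0 n n0n; have h2 := Hn0 n.+1 (leqW n0n).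
have nlam : 3 * lam <= d * n%:R.
  rewrite [leRHS]mulrC -ler_pdivrMr//; apply: le_trans (ltW (truncnS_gt _)) _.
  by rewrite ler_nat; apply: leq_trans n1n; rewrite leq_maxr.
have n1' : 1 <= n%:R :> R by rewrite ler1n; apply: leq_trans n1n; rewrite leq_max orbT.
have q1 := Qm _ _ nN; have q2 := Qm _ _ (ltnW Nn1).
have r1 : n%:R ^+ 2 <= N%:R :> R by rewrite -natrX ler_nat.
have r2 : N%:R <= n.+1%:R ^+ 2 :> R by rewrite -natrX ler_nat ltnW.
rewrite -natr1 in h2 r2.
have eE : e = 5 * d by rewrite /d; lra.
rewrite eE; move: h1 h2 q1 q2 r1 r2 nlam n1'.
move: (n%:R : R) (N%:R : R) (Q N) (Q (n ^ 2)%N) (Q (n.+1 ^ 2)%N) => w W u v z.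
rewrite !ler_norml => /andP[v1 v2] /andP[z1 z2] vu uz r1 r2 nlam w1.
have lw : lam * (3 * w) <= d * w ^+ 2 by nra.
have lam1 : lam * W <= lam * (w + 1) ^+ 2 by rewrite ler_wpM2l.
have lam2 : lam * w ^+ 2 <= lam * W by rewrite ler_wpM2l.
have dW : d * w ^+ 2 <= d * W by rewrite ler_pM2l.
have dw : d * (w + 1) ^+ 2 <= d * (4 * w ^+ 2) by rewrite ler_pM2l//; nra.
have lamw : lam * 1 <= lam * w by rewrite ler_wpM2l.
by apply/andP; split; lra.
Qed.

Lemma sum_inv_sq N : \sum_(0 <= n < N) (n.+1%:R ^- 2) <= 2 :> R.
Proof.
suff H M : \sum_(0 <= n < M.+1) (n.+1%:R ^- 2) <= 2 - M.+1%:R^-1 :> R.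
  case: N => [|N]; first by rewrite big_geq.
  by apply: le_trans (H N) _; rewrite gerBl invr_ge0.
elim: M => [|M IH]; first by rewrite big_nat1 expr1n invr1; lra.
rewrite big_nat_recr//=; apply: le_trans (lerD IH (lexx _)) _.
have m0 : 0 < M.+1%:R :> R by rewrite ltr0n.
have -> : M.+2%:R = M.+1%:R + 1 :> R by rewrite natr1.
move: (M.+1%:R : R) m0 => w w0.
rewrite -subr_ge0 (_ : _ - _ = (w * (w + 1) ^+ 2)^-1); last by field; rewrite ?gt_eqF//; lra.
by rewrite invr_ge0 mulr_ge0 ?sqr_ge0// ltW.
Qed.

Lemma series_term_small (u : nat -> R) (r : R) : (forall n, 0 <= u n) ->
  (forall N, \sum_(0 <= n < N) u n <= r) ->
  forall e, 0 < e -> exists n0, forall n, (n0 <= n)%N -> u n <= e.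
Proof.
move=> u0 ur e e0.
have cu : cvgn (series u).
  apply: nondecreasing_is_cvgn.
    by apply/nondecreasing_seqP => n; rewrite seriesSr lerDl.
  by exists r => _ [N _ <-]; rewrite seriesEnat; exact: ur.
have /cvgrPdist_le/(_ e e0)[n0 _ hn0] := cvg_series_cvg_0 cu.
exists n0 => n nn; have := hn0 n nn.
by rewrite /= sub0r normrN ger0_norm.
Qed.

(** The square of [rsum (n ^ 2)] / n^2 has integral at most 72 / n^2. These are summable, so the
    series of squares is finite almost everywhere and its terms tend to 0. *)
Lemma rsum_squares_ae : {ae leb, forall c, c \in `[0, 1[ ->
  forall e, 0 < e -> exists n0, forall n, (n0 <= n)%N ->
    `|rsum (n ^ 2)%N c| <= e * n%:R ^+ 2}.
Proof.
pose U n c : \bar R := ((rsum (n.+1 ^ 2)%N c / n.+1%:R ^+ 2) ^+ 2)%:E.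
have U0 n c : (0 <= U n c)%E by rewrite lee_fin sqr_ge0.
have mU n : measurable_fun setT (U n).
  apply/measurable_EFinP; apply: measurable_funX.
  by apply: measurable_funM => //; exact: measurable_rsum.
have mF : measurable_fun setT (fun c => \sum_(0 <= n <oo) U n c)%E.
  apply: ge0_emeasurable_sum; first by move=> k y _ _; exact: U0.
  by move=> k _; exact: mU.
have F0 c : (0 <= \sum_(0 <= n <oo) U n c)%E by apply: nneseries_ge0 => n _ _.
have IU n : (\int[leb]_(c in `[0%R, 1%R[) U n c <= (72 * n.+1%:R ^- 2)%:E)%E.
  have w0 : 0 < n.+1%:R ^+ 2 :> R by rewrite exprn_gt0.
  pose z : R := (n.+1%:R ^+ 2)^-1 ^+ 2.
  have z0 : 0 <= z by rewrite sqr_ge0.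
  have -> : (\int[leb]_(c in `[0%R, 1%R[) U n c =
      z%:E * \int[leb]_(c in `[0%R, 1%R[) (rsum (n.+1 ^ 2)%N c ^+ 2)%:E)%E.
    rewrite -ge0_integralZl//; first last.
    - by move=> c _; rewrite lee_fin sqr_ge0.
    - apply: measurable_funTS; apply/measurable_EFinP; apply: measurable_funX.
      exact: measurable_rsum.
    by apply: eq_integral => c _; rewrite /U exprMn mulrC EFinM.
  have z0' : (0 <= z%:E)%E by rewrite lee_fin.
  apply: (le_trans (lee_wpmul2l z0' (@rsum_second_moment R (n.+1 ^ 2)))).
  rewrite -EFinM lee_fin natrX /z.
  move: (n.+1%:R ^+ 2 : R) w0 => w w0.
  by rewrite le_eqVlt; apply/orP; left; apply/eqP; field; rewrite gt_eqF.
have iF : leb.-integrable `[0%R, 1%R[ (fun c => \sum_(0 <= n <oo) U n c)%E.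
  apply/integrableP; split; first exact: measurable_funTS.
  under eq_integral do rewrite gee0_abs//.
  rewrite (integral_nneseries leb (measurable_itv _) (fun n => measurable_funTS (mU n)) (fun n c _ => U0 n c)).
  apply: (@le_lt_trans _ _ 144%:E); last exact: ltry.
  apply: lime_le; first by apply: is_cvg_nneseries => k _ _; apply: integral_ge0 => c _; exact: U0.
  apply: nearW => N.
  apply: (@le_trans _ _ (\sum_(0 <= n < N) (72 * n.+1%:R ^- 2)%:E)%E).
    by apply: lee_sum => n _; exact: IU.
  rewrite sumEFin lee_fin -mulr_sumr.
  have := sum_inv_sq N; lra.
have := integrable_ae _ iF; move=> /(_ (measurable_itv _)).
apply: filterS => c /[swap] c01 /(_ c01) Ffin e e0.
pose u n : R := (rsum (n.+1 ^ 2)%N c / n.+1%:R ^+ 2) ^+ 2.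
have u0 n : 0 <= u n by rewrite sqr_ge0.
have ub N : \sum_(0 <= n < N) u n <= fine (\sum_(0 <= n <oo) U n c)%E.
  rewrite -lee_fin fineK// -sumEFin.
  by apply: nneseries_lim_ge => n _ _; exact: U0.
have e2 : 0 < e ^+ 2 by rewrite exprn_gt0.
have [n0 hn0] := series_term_small u0 ub e2.
exists n0.+1 => -[//|n] nn; have := hn0 n nn.
rewrite /u -real_normK ?num_real// ler_sqr ?nnegrE ?(ltW e0)//.
by rewrite normrM [X in _ * X]gtr0_norm ?invr_gt0 ?exprn_gt0// ler_pdivrMr ?exprn_gt0.
Qed.

Lemma ret_neq0_ae : {ae leb, forall c, forall k, (0 < k)%N -> ret (2^-1 - c) k != 0}.
Proof.
apply: ae_foralln => -[|k]; first by apply: nearW.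
have fk := freq_gt0 (ltn0Sn k).
have fk0 : (freq k.+1)%:R != 0 :> R by rewrite pnatr_eq0 -lt0n.
have [N [mN N0 sN]] := negligible_integer_points (- ((freq k.+1)%:R / 2)) fk0.
exists N; split => // c /= /not_implyP[_ /negP]; rewrite negbK => /eqP h; apply: sN => /=.
by rewrite -h /ret -[LHS]snormN freqE; congr snorm; field.
Qed.

(** Where no return vanishes, [- logsum b n] is n ln 2 - [rsum n c] and nondecreasing in n.
    [squares_squeeze] with slope ln 2 then makes the averages converge, so the liminf is a limit. *)
Lemma mstar_ae : {ae leb, forall c, c \in `[0, 1[ -> mstar c = (- ln 2 : R)%:E}.
Proof.
have FF := @ae_filter_ringOfSetsType _ (measurableTypeR R) R leb.
apply: (@filterS2 _ _ FF _ _ _ _ rsum_squares_ae ret_neq0_ae) => c Hsq Hret c01.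
have {}Hsq := Hsq c01; set b := 2^-1 - c in Hret *.
have ls n : - logsum b n = ln 2 * n%:R - rsum n c.
  rewrite /rsum /logsum -sumrN.
  have -> : ln 2 * n%:R = \sum_(1 <= k < n.+1) ln 2 :> R.
    by rewrite sumr_const_nat subn1 mulr_natr.
  rewrite -sumrB big_nat [RHS]big_nat; apply: eq_bigr => k /andP[k0 _].
  rewrite rwaveE -/b lnM ?posrE//; first by ring.
  by rewrite lt_neqAle eq_sym Hret// ret_ge0.
have ln2_0 : 0 <= ln (2 : R) by rewrite ln_ge0// ler1n.
have mono : {homo (fun n => - logsum b n) : m n / (m <= n)%N >-> m <= n}.
  by move=> m n mn; rewrite lerN2 logsum_le.
have HQ e : 0 < e -> exists n0, forall n, (n0 <= n)%N ->
    `|- logsum b (n ^ 2)%N - ln 2 * n%:R ^+ 2| <= e * n%:R ^+ 2.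
  move=> e0; have [n0 hn0] := Hsq e e0; exists n0 => n nn.
  by rewrite ls natrX addrAC subrr add0r normrN; exact: hn0.
have key := squares_squeeze ln2_0 mono HQ.
rewrite /mstar -/b; apply: (cvg_limn_einf_sup _).1.
have -> : (fun n : nat => ((n%:R)^-1)%:E * \sum_(1 <= k < n.+1)
    elog `|sin (pi * (2 ^+ k * b - b))|)%E = EFin \o (fun n => n%:R^-1 * logsum b n).
  apply/funext => n; rewrite -[X in (_ * X)%E]/(retsum b n) retsumE ?EFinM//.
  by move=> k /andP[k0 _]; exact: Hret.
apply/cvg_EFin; first by apply: nearW.
apply/cvgrPdist_le => e e0; have [N0 hN0] := key e e0.
exists N0.+1 => // n /= nn; have n0 : (0 < n)%N by apply: leq_trans nn.
have n0' : 0 < n%:R :> R by rewrite ltr0n.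
have := hN0 n (ltnW nn).
rewrite -ler_pdivrMr// -[X in _ / X]gtr0_norm// -normf_div => h; apply: le_trans h.
rewrite le_eqVlt; apply/orP; left; apply/eqP; congr (`|_|); field.
by rewrite gt_eqF.
Qed.

End AlmostEverywhere.

Theorem theoremA (R : realType) :
  (* (1) *)
  (forall c : R, c \in `[0, 1[ -> (alpha c = -oo%E <-> mstar c = -oo%E)) /\
  (* (2) *)
  (forall c : R, c \in `[0, 1[ -> periodic_pt (2^-1 - c) -> alpha c = -oo%E) /\
  (* (3) *)
  (forall c : R, c \in `[0, 1[ -> preperiodic_pt (2^-1 - c) ->
      ~ periodic_pt (2^-1 - c) -> (-oo < alpha c)%E) /\
  (* (4) *)
  first_category (`[0, 1[ `\` [set c : R | alpha c = -oo%E]) /\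
  (* (5) *)
  {ae (@lebesgue_measure R), forall c : R,
      c \in `[0, 1[ -> mstar c = (- ln 2 : R)%:E} /\
  (* (6) *)
  hausdorff_dim [set c : R | (c \in `[0, 1[) /\ (alpha c = -oo%E)] = 0%E.
Proof.
split; first by move=> c _; exact: alpha_mstar.
split; first by move=> c _; exact: alpha_periodic_pt.
split; first by move=> c _; exact: alpha_preperiodic_pt.
split; first exact: first_category_alpha.
split; [exact: mstar_ae|exact: hausdorff_dim_alpha].
Qed.
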